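(* Let $\mathbf{F}_1$ be a random variable whose law is the free stable law $\mathbf{f}_1$. Then the Dykema–Haagerup distribution $\mathrm{DH}_1$ equals the law of $e^{\mathbf{F}_1}$: $$\mathrm{DH}_1=\mathcal{L}(e^{\mathbf{F}_1}).$$
   Context: The Dykema–Haagerup distribution $\mathrm{DH}_1$ is the (compactly supported, on $[0,e]$) probability measure on $[0,\infty)$ with moments $\int x^n\,\mathrm{DH}_1(dx)=\frac{n^n}{(n+1)!}$, $n=0,1,2,\dots$, with the convention $0^0=1$. For a probability measure $\mu$ on $\mathbb{R}$ let $G_\mu(z)=\int\frac{\mu(dx)}{z-x}$, $F_\mu=1/G_\mu$; the Voiculescu transform is $\varphi_\mu(z)=F_\mu^{-1}(z)-z$ on a suitable truncated cone $\{z:\Im z>0,|\Re z|<a\Im z,|z|>b\}$. The law $\mathbf{f}_1$ is the free $1$-stable probability measure on $\mathbb{R}$ determined by $\varphi_{\mathbf{f}_1}(z)=-\log z$ for $\Im z>0$ (principal logarithm). $\mathcal{L}(X)$ is the law of $X$. *)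

(* Defs.v *)
From HB Require Import structures.
From mathcomp Require Import all_boot all_order all_algebra.
From mathcomp Require Import all_classical all_reals all_analysis measurable_realfun.
From mathcomp Require Import complex.

Set Implicit Arguments.
Unset Strict Implicit.
Unset Printing Implicit Defensive.

Import Order.TTheory GRing.Theory Num.Theory.
Import numFieldNormedType.Exports.

Local Open Scope classical_set_scope.
Local Open Scope ring_scope.
Local Open Scope complex_scope.

Section ComplexAnalysis.
Context {R : realType}.
Implicit Types (z : R[i]).

(* [complex.Re] and [complex.Im] are R-valued; the norm `|z| of R[i] is not,
   hence the use of [Normc.normc] for the R-valued modulus. *)
Definition modulus (z : R[i]) : R := Normc.normc z.

(* Principal argument, in ]-pi, pi]; its value at 0 is irrelevant. *)
Definition Arg (z : R[i]) : R :=
  let t := acos (complex.Re z / modulus z) in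
  if 0 <= complex.Im z then t else - t.

Definition Log (z : R[i]) : R[i] := Complex (ln (modulus z)) (Arg z).

Definition Cintegral d (T : measurableType d)
    (mu : {measure set T -> \bar R}) (f : T -> R[i]) : R[i] :=
  Complex (Rintegral mu setT (fun x => complex.Re (f x)))
          (Rintegral mu setT (fun x => complex.Im (f x))).

Definition truncated_cone (a b : R) : set R[i] :=
  [set z | [/\ 0 < complex.Im z, `|complex.Re z| < a * complex.Im z
             & b < modulus z]].

End ComplexAnalysis.

Section FreeProbability.
Context {R : realType}.
Implicit Types (mu : probability R R).

Definition cauchy_transform mu (z : R[i]) : R[i] :=
  Cintegral mu (fun x : R => (z - x%:C)^-1).

Definition reciprocal_cauchy_transform mu (z : R[i]) : R[i] :=
  (cauchy_transform mu z)^-1.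

(* [phi] is, on the truncated cone [D], the Voiculescu transform of [mu].
   The inverse of F_mu is the branch [g] near infinity: F_mu is injective on
   a truncated cone [E], and [g] is the inverse of that restriction,
   defined on [D] with values in [E]. *)
Definition voiculescu_transform_on mu (D : set R[i]) (phi : R[i] -> R[i]) :
    Prop :=
  exists (a b : R) (g : R[i] -> R[i]), let E := truncated_cone a b in
    [/\ 0 < a, 0 < b,
        set_inj E (reciprocal_cauchy_transform mu),
        {in D, forall z, g z \in E /\
                         reciprocal_cauchy_transform mu (g z) = z}
      & {in D, forall z, phi z = g z - z}].

Definition has_voiculescu_transform mu (phi : R[i] -> R[i]) : Prop :=
  exists a b : R,
    [/\ 0 < a, 0 < b & voiculescu_transform_on mu (truncated_cone a b) phi].

Definition is_free_stable1 mu : Prop :=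
  has_voiculescu_transform mu (fun z => - Log z).

(* For n = 0 the moment is 0%:R ^+ 0 / 1 = 1, i.e. 0^0 = 1. The integrals are
   extended-real valued, so the equality includes finiteness. *)
Definition is_dykema_haagerup1 mu : Prop :=
  mu [set x : R | 0 <= x] = 1%:E /\
  forall n : nat,
    (\int[mu]_x (x ^+ n)%:E)%E = (n%:R ^+ n / (n.+1)`!%:R)%:E.

End FreeProbability.

(* Main.v *)
(* Let [G] be the Cauchy transform of the law of [X = F1]. Differentiating the
   hypothesis [G (z - Log z) = 1/z] along [z = i y] shows that
   [G' (1 - G) + G^2 = 0] on a curve, hence on the whole upper half-plane by the
   identity theorem. This equation makes [1/G + log G - W] constant, equal to 0,
   and makes [G - log G] a primitive of [G], so that
   [E arg (W - X) = Im (G - log G)]. Writing [1/G] in polar form and letting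
   [Im W] tend to 0 yields, with [w(t) = t cot t + ln (sin t / t)],
     [pi P(X > w(t)) = t - sin^2 t / t]   for [0 < t < pi].
   The moments [E e^(nX)] are then integrals of [e^(nz) z^-k dz] along the curve
   [z = (t / sin t) e^(it)]; integrations by parts reduce them to [k = 1], and
   the independence of [int Im (e^(uz) / z) dz = pi] from [u > 0] gives
   [E e^(nX) = n^n / (n+1)!]. Both laws live on a bounded interval, where the
   moments determine the law. *)
Require Import Defs.
From HB Require Import structures.
From mathcomp Require Import all_boot all_order all_algebra.
From mathcomp Require Import all_classical all_reals all_analysis measurable_realfun.
From mathcomp Require Import complex.
From mathcomp Require Import ring lra.

Set Implicit Arguments.
Unset Strict Implicit.
Unset Printing Implicit Defensive.

Import Order.TTheory GRing.Theory Num.Theory.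
Import numFieldNormedType.Exports.

Local Open Scope classical_set_scope.
Local Open Scope ring_scope.
Local Open Scope complex_scope.

(** * Integrals of bounded complex functions *)

Section Modulus.
Context {R : realType}.
Implicit Types z w : R[i].

(** The hypothesis enters only at [z = i y], a point of every truncated cone once [y] is large. A
    single disc then suffices for the identity theorem: a centre [W0] on the curve has imaginary
    part [y - pi / 2] but real part only [- ln y], so the disc of radius [Im W0] around it contains
    any given point of the half-plane when [y] is large. The logarithm of [G] is split into real and
    imaginary parts: [Im G < 0] lets an arctangent give the argument, and all derivatives are real
    ones, along segments. The primitive of [G] is known up to a constant, which the bounds
    [0 <= E arg (W - X) <= pi] force to be 0. No density of the law is formed: the tail moments [E
    [e^(nX); X > w(t)]] are differentiated in [t] as Stieltjes integrals, and integrals over []0,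
    pi[] are replaced by limits of increments of primitives. *)

Lemma modulus_ge0 z : 0 <= modulus z.
Proof. by case: z => a b; rewrite /modulus/= sqrtr_ge0. Qed.

Lemma modulusM z w : modulus (z * w) = modulus z * modulus w.
Proof. exact: Normc.normcM. Qed.

Lemma modulusV z : modulus z^-1 = (modulus z)^-1.
Proof. exact: Normc.normcV. Qed.

Lemma modulusD z w : modulus (z + w) <= modulus z + modulus w.
Proof. exact: le_normcD. Qed.

Lemma modulusN z : modulus (- z) = modulus z.
Proof. exact: normcN. Qed.

Lemma modulus0 : modulus (0 : R[i]) = 0.
Proof. exact: Normc.normc0. Qed.

Lemma modulus1 : modulus (1 : R[i]) = 1.
Proof. exact: Normc.normc1. Qed.

Lemma modulus_eq0 z : modulus z = 0 -> z = 0.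
Proof. exact: Normc.eq0_normc. Qed.

Lemma modulusX z n : modulus (z ^+ n) = modulus z ^+ n.
Proof. by elim: n => [|n IH]; rewrite ?modulus1// !exprS modulusM IH. Qed.

Lemma modulus_nat n : modulus (n%:R : R[i]) = n%:R.
Proof.
have -> : (n%:R : R[i]) = (n%:R)%:C by rewrite rmorph_nat.
by rewrite /modulus/= expr0n/= addr0 sqrtr_sqr ger0_norm.
Qed.

Lemma normr_Re z : `|complex.Re z| <= modulus z.
Proof.
case: z => a b; rewrite /modulus/= -sqrtr_sqr ler_sqrt ?addr_ge0 ?sqr_ge0//.
by rewrite lerDl sqr_ge0.
Qed.

Lemma normr_Im z : `|complex.Im z| <= modulus z.
Proof.
case: z => a b; rewrite /modulus/= -sqrtr_sqr ler_sqrt ?addr_ge0 ?sqr_ge0//.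
by rewrite lerDr sqr_ge0.
Qed.

Lemma modulus_le z : modulus z <= `|complex.Re z| + `|complex.Im z|.
Proof.
case: z => a b; rewrite /modulus/=.
rewrite -[leRHS]ger0_norm ?addr_ge0// -sqrtr_sqr ler_sqrt ?sqr_ge0//.
rewrite sqrrD !real_normK ?num_real//.
by rewrite lerD2r lerDl mulrn_wge0// mulr_ge0.
Qed.

End Modulus.

Section BoundedComplexIntegral.
Context {d} {T : measurableType d} {R : realType} (mu : probability T R).
Implicit Types f g : T -> R[i].

(** [Rintegral] is additive only on integrable functions. Bounded measurable functions are
    integrable for a probability measure and form a ring, so every product of resolvents met below
    is covered. *)
Definition bounded_mfun f : Prop :=
  [/\ measurable_fun setT (fun x => complex.Re (f x)),
      measurable_fun setT (fun x => complex.Im (f x))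
    & exists M, forall x, modulus (f x) <= M].

Lemma bounded_integrable (f : T -> R) (M : R) :
  measurable_fun setT f -> (forall x, `|f x| <= M) ->
  mu.-integrable setT (EFin \o f).
Proof.
move=> mf fM.
apply: (@le_integrable _ _ _ mu setT measurableT _ (EFin \o cst M)) => //.
- exact/measurable_EFinP.
- move=> x _ /=; rewrite lee_fin (le_trans (fM x))// ler_norm//.
- by apply: finite_measure_integrable_cst.
Qed.

Lemma integrableMl_cst (a : R) (f : T -> R) :
  mu.-integrable setT (EFin \o f) ->
  mu.-integrable setT (EFin \o (fun x => a * f x)).
Proof.
move=> fi; rewrite (_ : _ \o _ = (fun x => a%:E * (EFin \o f) x)%E).
  exact: integrableZl.
by apply/funext => x /=; rewrite EFinM.
Qed.

Lemma bounded_mfun_Re f : bounded_mfun f ->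
  mu.-integrable setT (EFin \o (fun x => complex.Re (f x))).
Proof.
move=> [mr mi [M fM]]; apply: (@bounded_integrable _ M) => // x.
by rewrite (le_trans (normr_Re _)).
Qed.

Lemma bounded_mfun_Im f : bounded_mfun f ->
  mu.-integrable setT (EFin \o (fun x => complex.Im (f x))).
Proof.
move=> [mr mi [M fM]]; apply: (@bounded_integrable _ M) => // x.
by rewrite (le_trans (normr_Im _)).
Qed.

Lemma bounded_mfunD f g : bounded_mfun f -> bounded_mfun g ->
  bounded_mfun (fun x => f x + g x).
Proof.
move=> [mf1 mf2 [M fM]] [mg1 mg2 [N gN]]; split.
- under eq_fun do rewrite raddfD; exact: measurable_funD.
- under eq_fun do rewrite raddfD; exact: measurable_funD.
- by exists (M + N) => x; rewrite (le_trans (modulusD _ _))// lerD.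
Qed.

Lemma Re_mulc (z w : R[i]) : complex.Re (z * w) =
  complex.Re z * complex.Re w - complex.Im z * complex.Im w.
Proof. by case: z w => [a b] [a' b']. Qed.

Lemma Im_mulc (z w : R[i]) : complex.Im (z * w) =
  complex.Re z * complex.Im w + complex.Im z * complex.Re w.
Proof. by case: z w => [a b] [a' b'] /=. Qed.

Lemma bounded_mfunM f g : bounded_mfun f -> bounded_mfun g ->
  bounded_mfun (fun x => f x * g x).
Proof.
move=> [mf1 mf2 [M fM]] [mg1 mg2 [N gN]]; split.
- under eq_fun do rewrite Re_mulc.
  by apply: measurable_funB; exact: measurable_funM.
- under eq_fun do rewrite Im_mulc.
  by apply: measurable_funD; exact: measurable_funM.
- exists (M * N) => x; rewrite modulusM ler_pM// ?modulus_ge0//.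
Qed.

Lemma bounded_mfun_cst (c : R[i]) : bounded_mfun (fun=> c).
Proof. by split=> //; exists (modulus c). Qed.

Lemma bounded_mfunX f n : bounded_mfun f -> bounded_mfun (fun x => f x ^+ n).
Proof.
move=> bf; elim: n => [|n IH].
  by under eq_fun do rewrite expr0; exact: bounded_mfun_cst.
by under eq_fun do rewrite exprS; exact: bounded_mfunM.
Qed.

Lemma CintegralD f g : bounded_mfun f -> bounded_mfun g ->
  Cintegral mu (fun x => f x + g x) = Cintegral mu f + Cintegral mu g.
Proof.
move=> bf bg; rewrite /Cintegral; apply/eqP; rewrite eq_complex/=.
apply/andP; split; apply/eqP.
- rewrite -RintegralD//; [|exact: bounded_mfun_Re..].
  by apply: eq_Rintegral => x _; rewrite raddfD.
- rewrite -RintegralD//; [|exact: bounded_mfun_Im..].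
  by apply: eq_Rintegral => x _; rewrite raddfD.
Qed.

Lemma CintegralZ c f : bounded_mfun f ->
  Cintegral mu (fun x => c * f x) = c * Cintegral mu f.
Proof.
move=> bf; have bRe := bounded_mfun_Re bf; have bIm := bounded_mfun_Im bf.
case: c => a b; rewrite /Cintegral; apply/eqP; rewrite eq_complex/=.
apply/andP; split; apply/eqP.
- rewrite -!RintegralZl// -RintegralB//.
  + by apply: eq_Rintegral => x _; rewrite Re_mulc.
  + exact: integrableMl_cst.
  + exact: integrableMl_cst.
- rewrite -!RintegralZl// -RintegralD//.
  + by apply: eq_Rintegral => x _; rewrite Im_mulc.
  + exact: integrableMl_cst.
  + exact: integrableMl_cst.
Qed.

Lemma le_normr_Rintegral_prob (f : T -> R) (M : R) : measurable_fun setT f ->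
  (forall x, `|f x| <= M) -> `|Rintegral mu setT f| <= M.
Proof.
move=> mf fM; have fi := bounded_integrable mf fM.
apply: (le_trans (le_normr_Rintegral measurableT fi)).
have -> : M = Rintegral mu setT (cst M).
  by rewrite Rintegral_cst// (congr1 (fun e => M * fine e) (probability_setT mu)) mulr1.
apply: le_Rintegral => //.
- apply: (@bounded_integrable _ M) => [|x]; last by rewrite normr_id.
  exact: measurableT_comp.
- exact: finite_measure_integrable_cst.
Qed.

(** The factor 2 comes from bounding the real and imaginary parts separately. *)
Lemma modulus_Cintegral f M : bounded_mfun f -> (forall x, modulus (f x) <= M) ->
  modulus (Cintegral mu f) <= 2 * M.
Proof.
move=> [mf1 mf2 _] fM; rewrite (le_trans (modulus_le _))//=.
rewrite (_ : 2 * M = M + M); last by rewrite mulr2n mulrDl mul1r.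
by apply: lerD; apply: le_normr_Rintegral_prob => // x;
  rewrite (le_trans _ (fM x))// ?normr_Re ?normr_Im.
Qed.

End BoundedComplexIntegral.

(** * Identity theorem *)

Section AnalyticDisc.
Context {R : realType}.
Implicit Types (f g : R[i] -> R[i]) (u : R[i]).

(** Bernoulli's inequality for [r / r0]. It absorbs the factor [n + 1] of a Cauchy product into a
    slightly larger rate, which is why growth is required below for every [r] above [s] and not for
    [s] itself. *)
Lemma linear_geometric_le (r0 r : R) : 0 < r0 -> r0 < r ->
  exists2 c, 0 <= c & forall n, n.+1%:R * r0 ^+ n <= c * r ^+ n.
Proof.
move=> r00 r0r; have r0' := lt_trans r00 r0r.
pose q := r / r0; pose d := q - 1.
have d0 : 0 < d by rewrite subr_gt0 ltr_pdivlMr// mul1r.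
have bern n : 1 + n%:R * d <= q ^+ n.
  elim: n => [|n IH]; first by rewrite mul0r addr0 expr0.
  have qE : q = 1 + d by rewrite /d; ring.
  rewrite exprS; apply: (@le_trans _ _ (q * (1 + n%:R * d))).
    rewrite qE -natr1 -subr_ge0 (_ : _ - _ = n%:R * (d * d)); last by ring.
    by rewrite mulr_ge0// mulr_ge0 ?ltW.
  by rewrite ler_wpM2l// qE addr_ge0// ltW.
exists (1 + d^-1) => [|n]; first by rewrite addr_ge0// invr_ge0 ltW.
have -> : r ^+ n = q ^+ n * r0 ^+ n by rewrite -exprMn divfK// gt_eqF.
rewrite mulrA ler_wpM2r ?exprn_ge0 ?(ltW r00)//.
rewrite (le_trans _ (ler_wpM2l _ (bern n))) ?addr_ge0 ?invr_ge0 ?(ltW d0)//.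
have -> : (1 + d^-1) * (1 + n%:R * d) = 1 + n%:R + n%:R * d + d^-1.
  by field; rewrite gt_eqF.
rewrite -natr1 addrC -addrA lerDl addr_ge0 ?invr_ge0 ?(ltW d0)//.
by rewrite mulr_ge0// ltW.
Qed.

(* [F n] is the [n]-th shifted power series [sum_k c_(n+k) u^k]; existence of
   such a family with growth rate at most [s] replaces the convergence of the
   Taylor series of [f] at 0. *)
Definition analytic_disc (delta s : R) f : Prop :=
  exists F : nat -> R[i] -> R[i],
  [/\ forall u, modulus u <= delta -> F 0%N u = f u,
      forall n u, modulus u <= delta -> F n u = F n 0 + u * F n.+1 u
    & forall r, s < r -> exists2 M, 0 <= M &
        forall n u, modulus u <= delta -> modulus (F n u) <= M * r ^+ n].

Lemma analytic_disc_cst delta s c : 0 <= s -> analytic_disc delta s (fun=> c).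
Proof.
move=> s0; exists (fun n _ => if n is 0%N then c else 0); split => //.
- by move=> [|n] u _; rewrite mulr0 addr0.
- move=> r sr; exists (modulus c) => [|n u _]; first exact: modulus_ge0.
  have r0 : 0 <= r by rewrite (le_trans s0)// ltW.
  case: n => [|n]; first by rewrite expr0 mulr1.
  by rewrite modulus0 mulr_ge0 ?modulus_ge0 ?exprn_ge0.
Qed.

Lemma analytic_discD delta s f g : analytic_disc delta s f ->
  analytic_disc delta s g -> analytic_disc delta s (fun u => f u + g u).
Proof.
move=> [F [F0 FS FM]] [G [G0 GS GM]].
exists (fun n u => F n u + G n u); split.
- by move=> u ud; rewrite F0// G0.
- by move=> n u ud; rewrite FS// GS//; ring.
- move=> r sr; have [M M0 hM] := FM r sr; have [N N0 hN] := GM r sr.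
  exists (M + N) => [|n u ud]; first exact: addr_ge0.
  by rewrite (le_trans (modulusD _ _))// mulrDl lerD ?hM ?hN.
Qed.

Lemma modulus_sum n (a : 'I_n -> R[i]) :
  modulus (\sum_(i < n) a i) <= \sum_(i < n) modulus (a i).
Proof.
elim/big_ind2 : _ => [|x1 x2 y1 y2 h1 h2|//]; first by rewrite modulus0.
by rewrite (le_trans (modulusD _ _))// lerD.
Qed.

(** Writing [f = sum_(i < n) a_i u^i + u^n F_n], the [n]-th shift of [f g] is
    [F_n g + sum_(i < n) a_i G_(n - i)]. Its [n + 1] terms are each [O(r0^n)], with [r0] halfway
    between [s] and [r]. *)
Lemma analytic_discM delta s f g : 0 <= delta -> 0 <= s ->
  analytic_disc delta s f -> analytic_disc delta s g ->
  analytic_disc delta s (fun u => f u * g u).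
Proof.
move=> delta0 s0 [F [F0 FS FM]] [G [G0 GS GM]].
have m0 : modulus (0 : R[i]) <= delta by rewrite modulus0.
exists (fun n u => F n u * G 0%N u + \sum_(i < n) F i 0 * G (n - i)%N u).
split.
- by move=> u ud; rewrite big_ord0 addr0 F0// G0.
- move=> n u ud; rewrite big_ord_recr/= subSnn.
  have -> : \sum_(i < n) F i 0 * G (n - i)%N u =
      \sum_(i < n) F i 0 * G (n - i)%N 0 +
      u * \sum_(i < n) F i 0 * G (n.+1 - i)%N u.
    rewrite mulr_sumr -big_split/=; apply: eq_bigr => i _.
    by rewrite (GS (n - i)%N)// subSn; [ring|exact: ltnW].
  rewrite (FS n u ud) (GS 0%N u ud); ring.
- move=> r sr; pose r0 := (s + r) / 2.
  have sr0 : s < r0 by rewrite /r0; lra.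
  have r0r : r0 < r by rewrite /r0; lra.
  have r00 : 0 < r0 by rewrite (le_lt_trans s0).
  have [M M0 hM] := FM r0 sr0; have [N N0 hN] := GM r0 sr0.
  have [c c0 hc] := linear_geometric_le r00 r0r.
  exists (M * N * c) => [|n u ud]; first by rewrite !mulr_ge0.
  rewrite -mulrA (le_trans _ (ler_wpM2l _ (hc n))) ?mulr_ge0//.
  rewrite (le_trans (modulusD _ _))//.
  have -> : M * N * (n.+1%:R * r0 ^+ n) =
      M * N * r0 ^+ n + \sum_(i < n) M * N * r0 ^+ n.
    by rewrite sumr_const card_ord -mulr_natl -natr1; ring.
  have bnd i j v w : modulus v <= delta -> modulus w <= delta ->
      modulus (F i v * G j w) <= M * N * r0 ^+ (i + j).
    move=> vd wd; rewrite modulusM exprD mulrACA ler_pM ?modulus_ge0 ?hM ?hN//.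
  rewrite lerD//; first by rewrite -[in leRHS](addn0 n) bnd.
  rewrite (le_trans (modulus_sum _))//; apply: ler_sum => i _.
  by rewrite (le_trans (bnd _ _ _ _ _ _))// subnKC// ltnW.
Qed.

Lemma analytic_discB delta s f g : 0 <= delta -> 0 <= s ->
  analytic_disc delta s f -> analytic_disc delta s g ->
  analytic_disc delta s (fun u => f u - g u).
Proof.
move=> d0 s0 hf hg; under eq_fun do rewrite -mulN1r.
apply: analytic_discD => //; apply: analytic_discM => //.
exact: analytic_disc_cst.
Qed.

Lemma geometric_lt_ex (x : R) (q e : R) : 0 <= q < 1 -> 0 < e ->
  exists n, x * q ^+ n < e.
Proof.
move=> /andP[q0 q1] e0.
have : (fun n => x * q ^+ n) @ \oo --> (x * 0 : R).
  by apply: cvgM; [exact: cvg_cst|apply: cvg_expr; rewrite ger0_norm].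
rewrite mulr0 => /cvgrPdist_lt/(_ e e0)[n _ /(_ n (leqnn n))] /=.
rewrite sub0r normrN => h; exists n; exact: le_lt_trans (ler_norm _) h.
Qed.

(** Nonzero zeros of [F n] accumulating at 0 force [F n 0 = 0], hence [F n u = u * F n.+1 u], and
    the same zeros serve for [F n.+1]. All coefficients vanish, so [f u = u ^+ n * F n u] for every
    [n], and the growth bound sends this to 0. *)
Lemma analytic_disc_identity delta s f : 0 <= delta -> 0 <= s ->
  analytic_disc delta s f ->
  (forall e, 0 < e -> exists u,
     [/\ u != 0, modulus u <= e, modulus u <= delta & f u = 0]) ->
  forall u, modulus u <= delta -> modulus u * s < 1 -> f u = 0.
Proof.
move=> delta0 s0 [F [F0 FS FM]] hz.
have m0 : modulus (0 : R[i]) <= delta by rewrite modulus0.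
have F0z n : (forall e, 0 < e -> exists u,
     [/\ u != 0, modulus u <= e, modulus u <= delta & F n u = 0]) -> F n 0 = 0.
  move=> IH; have [M M0 hM] := FM (s + 1) (ltr_pwDr ltr01 (lexx s)).
  apply: modulus_eq0; apply/eqP; rewrite eq_le modulus_ge0 andbT.
  apply/ler_addgt0Pl => e e0; rewrite addr0.
  pose K := M * (s + 1) ^+ n.+1 + 1.
  have K0 : 0 < K by rewrite ltr_wpDl// mulr_ge0// exprn_ge0// addr_ge0.
  have [u [u0 ue ud Fu]] := IH (e / K) (divr_gt0 e0 K0).
  have : F n 0 = - (u * F n.+1 u) by apply/eqP; rewrite -addr_eq0 -FS// Fu.
  move=> ->; rewrite modulusN modulusM.
  rewrite (@le_trans _ _ (e / K * K))//; last by rewrite divfK// gt_eqF.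
  rewrite ler_pM ?modulus_ge0//.
  by rewrite (le_trans (hM _ _ ud))// lerDl.
have Fz n : forall e, 0 < e -> exists u,
     [/\ u != 0, modulus u <= e, modulus u <= delta & F n u = 0].
  elim: n => [e e0|n IH e e0].
    by have [u [? ? ? ?]] := hz e e0; exists u; split => //; rewrite F0.
  have [u [u0 ue ud Fu]] := IH e e0; exists u; split => //.
  have := FS n u ud; rewrite Fu (F0z _ IH) add0r => /esym/eqP.
  by rewrite mulf_eq0 (negbTE u0)/= => /eqP.
have Fn0 n : F n 0 = 0 by exact/F0z/Fz.
move=> u ud us.
have fE n : f u = u ^+ n * F n u.
  elim: n => [|n IH]; first by rewrite expr0 mul1r F0.
  by rewrite IH FS// Fn0 add0r exprSr mulrA.
have [->|u0] := eqVneq u 0; first by rewrite -F0.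
have mu0 : 0 < modulus u.
  rewrite lt_neqAle modulus_ge0 andbT eq_sym.
  by apply: contra u0 => /eqP/modulus_eq0 ->.
(* A rate above [s] for which [modulus u * r < 1]. *)
pose r := (s + (modulus u)^-1) / 2.
have sV : s < (modulus u)^-1 by rewrite -[ltRHS]mul1r ltr_pdivlMr// mulrC.
have [M M0 hM] := FM r ltac:(rewrite /r; lra).
apply: modulus_eq0; apply/eqP; rewrite eq_le modulus_ge0 andbT.
have q01 : 0 <= modulus u * r < 1.
  apply/andP; split.
    by rewrite mulr_ge0 ?modulus_ge0// /r; lra.
  by rewrite mulrC -ltr_pdivlMr// mul1r /r; lra.
apply/ler_addgt0Pl => e e0; rewrite addr0.
have [n hn] := geometric_lt_ex M q01 e0.
rewrite (fE n) (le_trans _ (ltW hn))// modulusM modulusX exprMn mulrCA.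
by rewrite ler_wpM2l ?hM// exprn_ge0// modulus_ge0.
Qed.

End AnalyticDisc.

(** * Cauchy transforms *)

Section Resolvent.
Context {R : realType}.
Implicit Types (W u : R[i]) (x y : R).

Definition resolvent W x : R[i] := (W - x%:C)^-1.

Lemma Im_sub_real W x : complex.Im (W - x%:C) = complex.Im W.
Proof. by case: W => a b /=; rewrite oppr0 addr0. Qed.

Lemma subr_real_neq0 W x : 0 < complex.Im W -> W - x%:C != 0.
Proof.
by move=> W0; apply/eqP => /(congr1 (@complex.Im R)); rewrite Im_sub_real => h; rewrite h ltxx in W0.
Qed.

Lemma modulus_resolvent W x : 0 < complex.Im W ->
  modulus (resolvent W x) <= (complex.Im W)^-1.
Proof.
move=> W0; rewrite modulusV lef_pV2 ?posrE//.
  by rewrite -(Im_sub_real W x) (le_trans _ (normr_Im _))// ler_norm.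
by rewrite (lt_le_trans W0)// -(Im_sub_real W x) (le_trans _ (normr_Im _))// ler_norm.
Qed.

Lemma resolventE W x : resolvent W x =
  (complex.Re W - x) / ((complex.Re W - x) ^+ 2 + complex.Im W ^+ 2) +i*
  (- (complex.Im W / ((complex.Re W - x) ^+ 2 + complex.Im W ^+ 2))).
Proof.
case: W => a b; rewrite /resolvent /real_complex_def/=.
by rewrite /GRing.inv/= oppr0 addr0.
Qed.

Lemma bounded_mfun_resolvent W : 0 < complex.Im W -> bounded_mfun (resolvent W).
Proof.
move=> W0.
have mD : measurable_fun setT (fun x => ((complex.Re W - x) ^+ 2 + complex.Im W ^+ 2)^-1).
  apply: continuous_measurable_fun => x.
  apply: cvgV; first by rewrite gt_eqF// ltr_wpDl ?sqr_ge0// exprn_gt0.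
  by apply: cvgD; [apply: cvgM; apply: cvgB => //; exact: cvg_cst|exact: cvg_cst].
have mS : measurable_fun setT (fun x : R => complex.Re W - x) by exact: measurable_funB.
split.
- by under eq_fun do rewrite resolventE/=; exact: measurable_funM.
- under eq_fun do rewrite resolventE/=.
  by apply: measurableT_comp => //; exact: measurable_funM.
- by exists (complex.Im W)^-1 => x; exact: modulus_resolvent.
Qed.

(** The resolvent identity; iterated under the integral, it yields every expansion of the Cauchy
    transform used below. *)
Lemma resolventD W u x : 0 < complex.Im W -> 0 < complex.Im (W + u) ->
  resolvent (W + u) x =
  resolvent W x - u * (resolvent W x * resolvent (W + u) x).
Proof.
move=> W0 Wu0; rewrite /resolvent.
by field; rewrite !subr_real_neq0.
Qed.

End Resolvent.

(** * Power series of the Cauchy transform and of its derivative *)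

Section CauchyTransform.
Context {R : realType} (mu : probability R R).
Implicit Types (W u : R[i]) (x y : R).

Let G := cauchy_transform mu.

(** This is [- G']. *)
Definition cauchy_transform2 W : R[i] :=
  Cintegral mu (fun x => resolvent W x ^+ 2).

Let bres := @bounded_mfun_resolvent R.

Lemma cauchy_taylor1 W u : 0 < complex.Im W -> 0 < complex.Im (W + u) ->
  G (W + u) = G W - u * Cintegral mu (fun x => resolvent W x * resolvent (W + u) x).
Proof.
move=> W0 Wu0; rewrite -mulNr -CintegralZ; last exact/bounded_mfunM/bres/Wu0/bres.
rewrite -CintegralD; last 2 first.
- exact: bres.
- by apply: bounded_mfunM; [exact: bounded_mfun_cst|apply: bounded_mfunM; exact: bres].
congr Cintegral; apply/funext => x; rewrite mulNr.
exact: resolventD.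
Qed.

Lemma cauchy_taylor2 W u : 0 < complex.Im W -> 0 < complex.Im (W + u) ->
  exists2 c, modulus c <= 2 * ((complex.Im W) ^- 2 * (complex.Im (W + u))^-1) &
  G (W + u) = G W - u * cauchy_transform2 W + u ^+ 2 * c.
Proof.
move=> W0 Wu0.
have b2 : bounded_mfun (fun x => resolvent W x ^+ 2 * resolvent (W + u) x).
  by apply: bounded_mfunM; [apply: bounded_mfunX|]; exact: bres.
exists (Cintegral mu (fun x => resolvent W x ^+ 2 * resolvent (W + u) x)).
  apply: modulus_Cintegral => // x; rewrite modulusM modulusX -exprVn.
  by rewrite ler_pM ?exprn_ge0 ?modulus_ge0 ?modulus_resolvent// lerXn2r ?nnegrE
    ?modulus_ge0 ?modulus_resolvent ?invr_ge0 ?(ltW W0).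
rewrite cauchy_taylor1//.
set c := Cintegral mu (fun x => _ ^+ 2 * _).
suff -> : Cintegral mu (fun x => resolvent W x * resolvent (W + u) x) =
    cauchy_transform2 W + (- u) * c by ring.
rewrite -CintegralZ// -CintegralD; last 2 first.
- exact/bounded_mfunX/bres.
- by apply: bounded_mfunM => //; exact: bounded_mfun_cst.
congr Cintegral; apply/funext => x.
by rewrite [in LHS]resolventD//; ring.
Qed.

Lemma Im_ge W u : complex.Im W - modulus u <= complex.Im (W + u).
Proof.
rewrite raddfD/= lerD2l lerNl (le_trans _ (normr_Im u))//.
by rewrite -normrN ler_norm.
Qed.

(** The [n]-th shifted series is the integral of [(- resolvent W) ^+ n * resolvent (W + u)], and
    [resolvent W] is at most [1 / Im W]. The condition on [delta] keeps [resolvent (W + u)]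
    uniformly bounded. *)
Lemma analytic_disc_cauchy W delta : 0 < complex.Im W -> delta < complex.Im W ->
  analytic_disc delta (complex.Im W)^-1 (fun u => G (W + u)).
Proof.
move=> W0 dW; set s := _^-1.
have s0 : 0 <= s by rewrite invr_ge0 ltW.
have Wu u : modulus u <= delta -> complex.Im W - delta <= complex.Im (W + u).
  by move=> ud; rewrite (le_trans _ (Im_ge _ _))// lerB.
have Wu0 u : modulus u <= delta -> 0 < complex.Im (W + u).
  by move=> /Wu; apply: lt_le_trans; rewrite subr_gt0.
pose F (n : nat) u x := (- resolvent W x) ^+ n * resolvent (W + u) x.
have bF n u : modulus u <= delta -> bounded_mfun (F n u).
  move=> ud; apply: bounded_mfunM; last exact/bres/Wu0.
  apply: bounded_mfunX; under eq_fun do rewrite -mulN1r.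
  by apply: bounded_mfunM; [exact: bounded_mfun_cst|exact: bres].
exists (fun n u => Cintegral mu (F n u)); split.
- move=> u ud; congr Cintegral; apply/funext => x.
  by rewrite /F expr0 mul1r.
- move=> n u ud; have d0 : modulus (0 : R[i]) <= delta.
    by rewrite modulus0 (le_trans (modulus_ge0 u)).
  rewrite -CintegralZ; last exact: bF.
  rewrite -CintegralD; last 2 first.
  + exact: bF.
  + by apply: bounded_mfunM; [exact: bounded_mfun_cst|exact: bF].
  congr Cintegral; apply/funext => x; rewrite /F addr0.
  by rewrite [in LHS]resolventD ?Wu0// exprS; ring.
- move=> r sr; have r0 := le_lt_trans s0 sr.
  exists (2 * (complex.Im W - delta)^-1) => [|n u ud].
    by rewrite mulr_ge0// invr_ge0 subr_ge0 ltW.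
  rewrite -mulrA; apply: modulus_Cintegral; first exact: bF.
  move=> x; rewrite modulusM modulusX modulusN mulrC.
  rewrite ler_pM ?exprn_ge0 ?modulus_ge0//.
    rewrite (le_trans (modulus_resolvent _ _)) ?Wu0// lef_pV2 ?Wu// posrE ?Wu0//.
    by rewrite subr_gt0.
  rewrite lerXn2r ?nnegrE ?modulus_ge0 ?(ltW r0)//.
  by rewrite (le_trans (modulus_resolvent _ _))// ltW.
Qed.

Lemma analytic_disc_cauchy2 W delta : 0 < complex.Im W -> delta < complex.Im W ->
  analytic_disc delta (complex.Im W)^-1 (fun u => cauchy_transform2 (W + u)).
Proof.
move=> W0 dW; set s := _^-1.
have s0 : 0 < s by rewrite invr_gt0.
have Wu u : modulus u <= delta -> complex.Im W - delta <= complex.Im (W + u).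
  by move=> ud; rewrite (le_trans _ (Im_ge _ _))// lerB.
have Wu0 u : modulus u <= delta -> 0 < complex.Im (W + u).
  by move=> /Wu; apply: lt_le_trans; rewrite subr_gt0.
(* The shifted series of the square of the resolvent; at [u = 0] it is [(n + 1) (- A)^n A^2] with
   [A = resolvent W x]. The linear factor [n] is absorbed by [linear_geometric_le]. *)
pose F (n : nat) u x := (- resolvent W x) ^+ n *
  (resolvent (W + u) x ^+ 2 + n%:R * (resolvent W x * resolvent (W + u) x)).
have bF n u : modulus u <= delta -> bounded_mfun (F n u).
  move=> ud; apply: bounded_mfunM.
    apply: bounded_mfunX; under eq_fun do rewrite -mulN1r.
    by apply: bounded_mfunM; [exact: bounded_mfun_cst|exact: bres].
  apply: bounded_mfunD; first exact/bounded_mfunX/bres/Wu0.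
  apply: bounded_mfunM; first exact: bounded_mfun_cst.
  by apply: bounded_mfunM; [exact: bres|exact/bres/Wu0].
exists (fun n u => Cintegral mu (F n u)); split.
- move=> u ud; congr Cintegral; apply/funext => x.
  by rewrite /F expr0 mul1r mul0r addr0.
- move=> n u ud; have d0 : modulus (0 : R[i]) <= delta.
    by rewrite modulus0 (le_trans (modulus_ge0 u)).
  rewrite -CintegralZ; last exact: bF.
  rewrite -CintegralD; last 2 first.
  + exact: bF.
  + by apply: bounded_mfunM; [exact: bounded_mfun_cst|exact: bF].
  congr Cintegral; apply/funext => x; rewrite /F addr0 -natr1 (exprS _ n).
  have := @resolventD R W u x W0 (Wu0 u ud).
  move: (resolvent W x) (resolvent (W + u) x) => A B AB.
  have eB : B ^+ 2 = A ^+ 2 - u * (A * B * (B + A)).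
    have -> : B ^+ 2 = A ^+ 2 + (B - A) * (B + A) by ring.
    by rewrite {1}AB; ring.
  have eAB : n%:R * (A * B) = n%:R * (A * A) - u * (n%:R * A * (A * B)).
    by rewrite {1}AB; ring.
  by rewrite [in LHS]eB [in LHS]eAB; ring.
- move=> r sr; have r0 := lt_trans s0 sr.
  have [c c0 hc] := linear_geometric_le s0 sr.
  pose t := (complex.Im W - delta)^-1.
  have t0 : 0 < t by rewrite invr_gt0 subr_gt0.
  have tR u x : modulus u <= delta -> modulus (resolvent (W + u) x) <= t.
    move=> ud; rewrite (le_trans (modulus_resolvent _ _)) ?Wu0//.
    by rewrite lef_pV2 ?Wu// posrE ?Wu0// subr_gt0.
  have sR x : modulus (resolvent W x) <= s by exact: modulus_resolvent.
  exists (2 * (t ^+ 2 + s * t) * c) => [|n u ud].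
    by rewrite !mulr_ge0// addr_ge0 ?mulr_ge0 ?exprn_ge0 ?(ltW t0) ?(ltW s0).
  rewrite -2!mulrA -(mulrA (t ^+ 2 + s * t)); apply: modulus_Cintegral; first exact: bF.
  have st0 : 0 <= t ^+ 2 + s * t.
    by rewrite addr_ge0 ?mulr_ge0 ?exprn_ge0 ?(ltW t0) ?(ltW s0).
  move=> x; rewrite (le_trans _ (ler_wpM2l st0 (hc n)))//.
  rewrite [leRHS](_ : _ = s ^+ n * ((t ^+ 2 + s * t) * n.+1%:R)); last by ring.
  rewrite modulusM modulusX modulusN.
  rewrite ler_pM ?exprn_ge0 ?modulus_ge0//.
    by rewrite lerXn2r ?nnegrE ?modulus_ge0 ?(ltW s0).
  rewrite (le_trans (modulusD _ _))// modulusX !modulusM modulus_nat mulrDl.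
  rewrite lerD//.
    rewrite (@le_trans _ _ (t ^+ 2))//.
      by rewrite lerXn2r ?nnegrE ?modulus_ge0 ?(ltW t0) ?tR.
    by rewrite ler_peMr ?exprn_ge0 ?(ltW t0)// ler1n.
  rewrite mulrC ler_pM ?mulr_ge0 ?modulus_ge0// ?ler_nat//.
  by rewrite ler_pM ?modulus_ge0 ?tR.
Qed.

End CauchyTransform.

(** * The differential equation of the Cauchy transform *)

Section CauchyEquation.
Context {R : realType} (mu : probability R R).
Implicit Types (W u : R[i]) (x y : R).

Let G := cauchy_transform mu.
Let G2 := cauchy_transform2 mu.

(* [z - Log z] at [z = i y] *)
Definition log_curve y : R[i] := (- ln y) +i* (y - pi / 2).

Variable b : R.
Hypothesis b_ge2 : 2 <= b.
Hypothesis GE : forall y, b < y -> G (log_curve y) = (0 +i* y)^-1.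

Lemma ler_mul_gt0_eq0 (m C : R) : 0 <= m -> (forall h, 0 < h -> m <= h * C) -> m = 0.
Proof.
move=> m0 hm; apply/eqP; rewrite eq_le m0 andbT.
have C0 : 0 <= C by rewrite (le_trans m0)// (le_trans (hm 1 ltr01))// mul1r.
apply/ler_addgt0Pl => e e0; rewrite addr0.
have C1 : 0 < C + 1 by rewrite ltr_wpDl.
rewrite (le_trans (hm (e / (C + 1)) _)) ?divr_gt0//.
by rewrite -mulrA ler_piMr ?(ltW e0)// mulrC ler_pdivrMr// mul1r lerDl.
Qed.

(** Both sides come from [ln (1 + x) <= x], taken at [x = h / y] and at [1 + x = (1 + h / y)^-1]. *)
Lemma ln_incr_bounds y h : 0 < y -> 0 < h ->
  0 <= (ln (y + h) - ln y) / h <= y^-1 /\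
  `|(ln (y + h) - ln y) / h - y^-1| <= h / y ^+ 2.
Proof.
move=> y0 h0; have yh0 : 0 < y + h by rewrite addr_gt0.
have lE : ln (y + h) - ln y = ln (1 + h / y).
  rewrite -ln_div ?posrE//; congr ln; field; rewrite gt_eqF//.
have hy0 : 0 < h / y by rewrite divr_gt0.
have u1 : (ln (y + h) - ln y) / h <= y^-1.
  by rewrite lE ler_pdivrMr// [leRHS]mulrC le_ln1Dx// (lt_trans _ hy0)// ltrN10.
have l1 : y^-1 - h / y ^+ 2 <= (ln (y + h) - ln y) / h.
  have : ln ((1 + h / y)^-1) <= (1 + h / y)^-1 - 1.
    have {1}-> : (1 + h / y)^-1 = 1 + ((1 + h / y)^-1 - 1) by ring.
    by apply: le_ln1Dx; rewrite ltrDr invr_gt0 addr_gt0.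
  rewrite lnV ?posrE ?addr_gt0// -lE => hl.
  rewrite ler_pdivlMr//.
  suff : (y^-1 - h / y ^+ 2) * h <= 1 - (1 + h / y)^-1 by lra.
  rewrite -subr_ge0.
  have -> : 1 - (1 + h / y)^-1 - (y^-1 - h / y ^+ 2) * h =
     h ^+ 3 / (y ^+ 2 * (y + h)) by field; rewrite !gt_eqF.
  by rewrite divr_ge0 ?mulr_ge0 ?exprn_ge0 ?ltW.
have l2 : 0 <= (ln (y + h) - ln y) / h.
  by rewrite divr_ge0 ?(ltW h0)// subr_ge0 ler_ln ?posrE// lerDl ltW.
split; first by rewrite l2.
by rewrite ler0_norm ?subr_le0// opprB lerBlDl -lerBlDr.
Qed.

Lemma log_curve_Im y : b < y -> 0 < complex.Im (log_curve y).
Proof.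
move=> yb.
by rewrite /= subr_gt0 (lt_trans _ yb)// (lt_le_trans _ b_ge2)// pihalf_lt2.
Qed.

Lemma log_curveD y h : 0 < h -> b < y ->
  log_curve (y + h) =
  log_curve y + h%:C * ((- ((ln (y + h) - ln y) / h)) +i* 1).
Proof.
move=> h0 yb; apply/eqP; rewrite eq_complex/=; apply/andP; split; apply/eqP.
  by field; rewrite gt_eqF.
by ring.
Qed.

Lemma cauchy_ode_curve y : b < y ->
  G2 (log_curve y) * (1 - G (log_curve y)) = G (log_curve y) ^+ 2.
Proof.
move=> yb; have y0 : 0 < y by rewrite (lt_trans _ yb)// (lt_le_trans _ b_ge2).
have yC0 : y%:C != 0 :> R[i] by rewrite fmorph_eq0 gt_eqF.
set W := log_curve y; have W0 : 0 < complex.Im W by exact: log_curve_Im.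
pose v0 : R[i] := (- y^-1) +i* 1.
set eta := complex.Im W.
(* Three errors of order [h]: replacing [1 / (y (y + h))] by [1 / y^2], replacing the slope of the
   chord by the velocity [v0], and the Taylor remainder of [G]. *)
pose C := y ^- 3 + modulus (G2 W) / y ^+ 2 + (1 + y^-1) ^+ 2 * (2 * (eta ^- 2 * eta^-1)).
(* The derivative in [y] of [1 / (i y) - G (log_curve y)], bounded by [h * C] for every [h > 0]
   through difference quotients. *)
have key : modulus ('i * (y%:C) ^- 2 + v0 * G2 W) = 0.
  apply: (@ler_mul_gt0_eq0 _ C); first exact: modulus_ge0.
  move=> h h0; have hC0 : h%:C != 0 :> R[i] by rewrite fmorph_eq0 gt_eqF.
  have [/andP[l0 l1] l2] := ln_incr_bounds y0 h0.
  have ybh : b < y + h by rewrite (lt_trans yb)// ltrDl.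
  have yhC0 : (y%:C + h%:C) != 0 :> R[i].
    by rewrite -rmorphD fmorph_eq0 gt_eqF// addr_gt0.
  have := GE ybh; rewrite log_curveD//; set v := _ +i* 1 => GE'.
  have Wu0 : 0 < complex.Im (W + h%:C * v).
    by have := log_curve_Im ybh; rewrite log_curveD.
  have [c cb] := cauchy_taylor2 mu W0 Wu0; rewrite -/G -/G2 GE' GE// => eqG.
  have iE x : (0 +i* x) = 'i * x%:C :> R[i].
    by apply/eqP; rewrite eq_complex/=; apply/andP; split; apply/eqP; ring.
  have i0 : 'i != 0 :> R[i] by apply/eqP => -[] /eqP; rewrite oner_eq0.
  have eq1 : 'i * (y%:C * (y%:C + h%:C))^-1 = - v * G2 W + h%:C * v ^+ 2 * c.
    have : h%:C * ('i * (y%:C * (y%:C + h%:C))^-1) =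
        h%:C * (- v * G2 W + h%:C * v ^+ 2 * c).
      have -> : h%:C * ('i * (y%:C * (y%:C + h%:C))^-1) =
          ('i * (y%:C + h%:C))^-1 - ('i * y%:C)^-1.
        have -> : ('i * (y%:C + h%:C))^-1 - ('i * y%:C)^-1 =
            - 'i ^+ 2 * (('i * (y%:C + h%:C))^-1 - ('i * y%:C)^-1).
          by rewrite sqr_i opprK mul1r.
        by field; rewrite i0 yC0 yhC0.
      by rewrite -(rmorphD (real_complex R)) -!iE eqG; ring.
    by move/(mulfI hC0).
  have -> : 'i * y%:C ^- 2 + v0 * G2 W =
    'i * h%:C * (y%:C ^+ 2 * (y%:C + h%:C))^-1 + (v0 - v) * G2 W + h%:C * v ^+ 2 * c.
    have -> : 'i * y%:C ^- 2 = 'i * h%:C * (y%:C ^+ 2 * (y%:C + h%:C))^-1 +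
      'i * (y%:C * (y%:C + h%:C))^-1 by field; rewrite yC0 yhC0.
    by rewrite eq1; ring.
  have mC x : 0 <= x -> modulus (x%:C : R[i]) = x.
    by move=> x0; rewrite /modulus/= expr0n/= addr0 sqrtr_sqr ger0_norm.
  have mi : modulus ('i : R[i]) = 1.
    by rewrite /modulus/= expr0n/= add0r expr1n sqrtr1.
  have mv0 : modulus (v0 - v) <= h / y ^+ 2.
    have -> : v0 - v = ((ln (y + h) - ln y) / h - y^-1)%:C.
      by apply/eqP; rewrite eq_complex/=; apply/andP; split; apply/eqP; ring.
    by rewrite /modulus/= expr0n/= addr0 sqrtr_sqr.
  have mv : modulus v <= 1 + y^-1.
    rewrite (le_trans (modulus_le _))//= normr1 addrC lerD2l normrN ger0_norm//.
  rewrite (le_trans (modulusD _ _))// (@le_trans _ _ (h * (y ^- 3 + modulus (G2 W) / y ^+ 2) +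
     h * ((1 + y^-1) ^+ 2 * (2 * (eta ^- 2 * eta^-1)))))//; last by rewrite -mulrDr.
  rewrite lerD//.
    rewrite (le_trans (modulusD _ _))// [leRHS]mulrDr lerD//.
      rewrite -rmorphD -rmorphXn -rmorphM -fmorphV 2!modulusM mi mul1r !mC ?(ltW h0)//.
        rewrite ler_wpM2l ?(ltW h0)// lef_pV2 ?posrE ?mulr_gt0 ?exprn_gt0 ?addr_gt0//.
        by rewrite exprSr ler_wpM2l ?exprn_ge0 ?(ltW y0)// lerDl ltW.
      by rewrite invr_ge0 mulr_ge0 ?exprn_ge0 ?addr_ge0 ?ltW.
    rewrite modulusM (_ : h * _ = h / y ^+ 2 * modulus (G2 W)); last by ring.
    by rewrite ler_wpM2r ?modulus_ge0.
  rewrite -mulrA modulusM mC ?(ltW h0)// ler_wpM2l ?(ltW h0)//.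
  rewrite modulusM ler_pM ?modulus_ge0//.
    by rewrite modulusX lerXn2r ?nnegrE ?modulus_ge0 ?addr_ge0 ?invr_ge0 ?(ltW y0).
  rewrite (le_trans cb)// ler_wpM2l// ler_wpM2l//.
    by rewrite invr_ge0 exprn_ge0// ltW.
  rewrite lef_pV2 ?posrE//.
  by rewrite raddfD/= mul0r addr0 mulr1 lerDl ltW.
have {}key := modulus_eq0 key.
rewrite (GE yb).
have yE : (0 +i* y)^-1 = - 'i * (y%:C)^-1 :> R[i].
  have -> : (0 +i* y) = 'i * y%:C :> R[i].
    by apply/eqP; rewrite eq_complex/=; apply/andP; split; apply/eqP; ring.
  rewrite invfM; congr (_ * _); apply/eqP.
  by rewrite eq_complex/=; apply/andP; split; apply/eqP; field.
(* Since [G = - i / y] on the curve, the velocity is [i (1 - G)] and [G^2 = - y^-2]; so [key]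
   multiplied by [- i] is the differential equation. *)
have v0E : v0 = 'i * (1 + 'i * y%:C^-1).
  rewrite -fmorphV; apply/eqP; rewrite eq_complex/=.
  by apply/andP; split; apply/eqP; ring.
rewrite yE; apply/eqP; rewrite -subr_eq0; apply/eqP.
have -> : G2 W * (1 - - 'i / y%:C) - (- 'i / y%:C) ^+ 2 =
  - 'i * ('i * y%:C ^- 2 + v0 * G2 W) + ('i ^+ 2 + 1) * (G2 W * (1 + 'i / y%:C)).
  by rewrite v0E; field.
by rewrite key sqr_i; ring.
Qed.

Lemma cauchy_ode W : 0 < complex.Im W -> G2 W * (1 - G W) = G W ^+ 2.
Proof.
case: W => x v /= v0.
(* The aim is [(x + ln y)^2 + (v - eta)^2 < eta^2] with [eta = y - pi / 2]. For [y = s^4] one has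
   [ln y <= 4 s], so the terms other than [2 v s^4] amount to at most [s^2 B], which [B <= s v]
   makes at most [s^4 v]. The summand [v * 4] pays for [v * pi]. *)
pose B := (`|x| + 4) ^+ 2 + v ^+ 2 + v * 4.
have B0 : 0 <= B by rewrite !addr_ge0 ?sqr_ge0 ?mulr_ge0 ?(ltW v0).
pose s : R := 1 + B / v + b.
have b0 : 0 < b by rewrite (lt_le_trans _ b_ge2).
have Bv0 : 0 <= B / v by exact: divr_ge0 B0 (ltW v0).
have s1 : 1 <= s by rewrite /s -addrA lerDl addr_ge0// (ltW b0).
have sB : B <= s * v.
  by rewrite -ler_pdivrMr// /s; lra.
have sb : b < s by rewrite /s; lra.
pose y := s ^+ 4.
have sy : s <= y by rewrite /y exprS ler_peMr ?(le_trans ler01)// exprn_ege1.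
have yb : b < y by rewrite (lt_le_trans sb).
set W0 := log_curve y; set W := x +i* v.
have eta0 : 0 < complex.Im W0 by exact: log_curve_Im.
set eta := complex.Im W0.
have s0 : 0 < s by rewrite (lt_le_trans _ s1).
have lny : 0 <= ln y <= 4 * s.
  rewrite ln_ge0 ?(le_trans s1)//=.
  have -> : ln y = 4 * ln s by rewrite /y lnXn// mulr_natl.
  by rewrite ler_wpM2l// ltW// ln_sublinear.
have dist : modulus (W - W0) < eta.
  have {1}-> : eta = Num.sqrt (eta ^+ 2) by rewrite sqrtr_sqr ger0_norm// ltW.
  rewrite /modulus/= ltr_sqrt ?exprn_gt0//.
  have etaE : eta = y - pi / 2 by [].
  have p4 := @pihalf_lt2 R; have p0 := pi_gt0 R.
  have q1 : (x - - ln y) ^+ 2 <= s ^+ 2 * (`|x| + 4) ^+ 2.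
    rewrite opprK -exprMn -[leLHS]real_normK ?num_real// lerXn2r ?nnegrE//.
      by rewrite mulr_ge0 ?(ltW s0)// addr_ge0.
    move/andP: lny => [l0 l1].
    rewrite (le_trans (ler_normD _ _))// mulrDr lerD//.
      by rewrite ler_peMl.
    by rewrite ger0_norm// mulrC.
  have -> : (v - (y - pi / 2)) ^+ 2 = v ^+ 2 - 2 * v * eta + eta ^+ 2.
    by rewrite etaE; ring.
  rewrite -subr_gt0.
  have q2 : 0 <= s ^+ 3 * (s * v - B).
    by rewrite mulr_ge0 ?exprn_ge0 ?(ltW s0)// subr_ge0.
  have q3 : s ^+ 2 * B <= s ^+ 3 * B.
    by rewrite ler_wpM2r// ler_weXn2l.
  have q4 : v ^+ 2 + v * 4 <= s ^+ 2 * (v ^+ 2 + v * 4).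
    by rewrite ler_peMl ?exprn_ege1// addr_ge0 ?sqr_ge0 ?mulr_ge0 ?(ltW v0).
  have q5 : 0 < v * s ^+ 4 by rewrite mulr_gt0 ?exprn_gt0.
  have q6 : 0 < v * (4 - pi) by rewrite mulr_gt0//; lra.
  rewrite etaE /y; rewrite /y in q1; rewrite /B in q2 q3.
  lra.
pose delta := (modulus (W - W0) + eta) / 2.
have d1 : delta < eta by rewrite /delta; lra.
have d2 : modulus (W - W0) < delta by rewrite /delta; lra.
have d0 : 0 < delta by rewrite (le_lt_trans _ d2)// modulus_ge0.
have eV0 : 0 <= eta^-1 by rewrite invr_ge0 ltW.
have AG := analytic_disc_cauchy mu eta0 d1.
have AG2 := analytic_disc_cauchy2 mu eta0 d1.
have AK : analytic_disc delta eta^-1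
    (fun u => G2 (W0 + u) * (1 - G (W0 + u)) - G (W0 + u) * G (W0 + u)).
  apply: analytic_discB; rewrite ?(ltW d0)//.
    apply: analytic_discM; rewrite ?(ltW d0)//.
    by apply: analytic_discB; rewrite ?(ltW d0)//; exact: analytic_disc_cst.
  by apply: analytic_discM; rewrite ?(ltW d0).
have := analytic_disc_identity (ltW d0) eV0 AK _ (ltW d2).
cbv beta; rewrite (addrC W0) subrK => H.
apply/eqP; rewrite -subr_eq0 expr2 H//; last first.
  by rewrite ltr_pdivrMr// mul1r.
move=> e e0; pose m := Num.min e delta.
have m0 : 0 < m by rewrite lt_min e0.
have y0 : 0 < y by rewrite exprn_gt0.
(* The zeros near [W0] are the points [log_curve (y + h)], at distance at most [h (1 + 1 / y)] from
   it. *)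
pose h := m / (1 + y^-1).
have yV1 : 0 < 1 + y^-1 by rewrite addr_gt0 ?invr_gt0.
have h0 : 0 < h by rewrite divr_gt0.
have [/andP[l0 l1] _] := ln_incr_bounds y0 h0.
pose u := h%:C * ((- ((ln (y + h) - ln y) / h)) +i* 1).
have mu_ : modulus u <= m.
  have -> : m = h * (1 + y^-1) by rewrite divfK// gt_eqF.
  rewrite modulusM ler_pM ?modulus_ge0//.
    by rewrite /modulus/= expr0n/= addr0 sqrtr_sqr ger0_norm// ltW.
  by rewrite (le_trans (modulus_le _))//= normr1 addrC lerD2l normrN ger0_norm.
exists u; split.
- apply/eqP => /(congr1 (@complex.Im R)) /=.
  by rewrite mul0r addr0 mulr1 => hh; rewrite hh ltxx in h0.
- by rewrite (le_trans mu_)// ge_min lexx.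
- by rewrite (le_trans mu_)// ge_min lexx orbT.
- rewrite -log_curveD// cauchy_ode_curve; last by rewrite (lt_trans yb)// ltrDl.
  by rewrite expr2 subrr.
Qed.

End CauchyEquation.

(** * Rules of derivation *)

Section DerivativeRules.
Context {R : realType}.
Implicit Types (f g : R -> R) (t a b c M : R).

Lemma is_derive1D f g t a b : is_derive t 1 f a -> is_derive t 1 g b ->
  is_derive t 1 (fun s => f s + g s) (a + b).
Proof. exact: is_deriveD. Qed.

Lemma is_derive1B f g t a b : is_derive t 1 f a -> is_derive t 1 g b ->
  is_derive t 1 (fun s => f s - g s) (a - b).
Proof. exact: is_deriveB. Qed.

Lemma is_derive1N f t a : is_derive t 1 f a -> is_derive t 1 (fun s => - f s) (- a).
Proof. exact: is_deriveN. Qed.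

Lemma is_derive1M f g t a b : is_derive t 1 f a -> is_derive t 1 g b ->
  is_derive t 1 (fun s => f s * g s) (a * g t + f t * b).
Proof.
move=> fa gb; have H := is_deriveM fa gb.
rewrite (_ : a * g t + f t * b = f t *: b + g t *: a); first exact: H.
by rewrite /GRing.scale/=; ring.
Qed.

Lemma is_derive1_cst c t : is_derive t 1 (fun=> c) 0.
Proof. exact: is_derive_cst. Qed.

Lemma is_derive1_id t : is_derive t 1 (fun s : R => s) 1.
Proof. exact: is_derive_id. Qed.

Lemma is_derive1Z f t a c : is_derive t 1 f a ->
  is_derive t 1 (fun s => c * f s) (c * a).
Proof.
move=> fa; have := is_derive1M (is_derive1_cst c t) fa.
by rewrite mul0r add0r.
Qed.

Lemma is_derive1_compose f g t a b : is_derive (g t) 1 f a -> is_derive t 1 g b ->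
  is_derive t 1 (fun s => f (g s)) (a * b).
Proof. exact: is_derive1_comp. Qed.

Lemma is_derive1_lnf f t a : 0 < f t -> is_derive t 1 f a ->
  is_derive t 1 (fun s => ln (f s)) (a / f t).
Proof.
move=> f0 fa; rewrite mulrC.
exact: (@is_derive1_compose (@ln R) f _ _ _ (is_derive1_ln f0) fa).
Qed.

Lemma is_derive1_expf f t a : is_derive t 1 f a ->
  is_derive t 1 (fun s => expR (f s)) (expR (f t) * a).
Proof.
exact: (@is_derive1_compose (@expR R) f _ _ _ (is_derive_expR (f t))).
Qed.

Lemma is_derive1_sinf f t a : is_derive t 1 f a ->
  is_derive t 1 (fun s => sin (f s)) (cos (f t) * a).
Proof.
exact: (@is_derive1_compose (@sin R) f _ _ _ (is_derive_sin (f t))).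
Qed.

Lemma is_derive1_cosf f t a : is_derive t 1 f a ->
  is_derive t 1 (fun s => cos (f s)) (- sin (f t) * a).
Proof.
exact: (@is_derive1_compose (@cos R) f _ _ _ (is_derive_cos (f t))).
Qed.

Lemma is_derive1V f t a : f t != 0 -> is_derive t 1 f a ->
  is_derive t 1 (fun s => (f s)^-1) (- a / f t ^+ 2).
Proof.
move=> f0 fa; have H := is_deriveV f0 fa.
rewrite (_ : - a / f t ^+ 2 = - (f t) ^- 2 *: a); first exact: H.
by rewrite /GRing.scale/=; field.
Qed.

Lemma is_derive1_div f g t a b : g t != 0 -> is_derive t 1 f a ->
  is_derive t 1 g b ->
  is_derive t 1 (fun s => f s / g s) ((a * g t - f t * b) / g t ^+ 2).
Proof.
move=> g0 fa gb; apply: (is_derive_eq (is_derive1M fa (is_derive1V g0 gb))).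
by field.
Qed.

Lemma is_derive1_atan_div f g t a b : g t != 0 -> is_derive t 1 f a ->
  is_derive t 1 g b ->
  is_derive t 1 (fun s => atan (f s / g s))
    ((a * g t - f t * b) / (f t ^+ 2 + g t ^+ 2)).
Proof.
move=> g0 fa gb;
apply: (is_derive_eq (is_derive1_compose (is_derive1_atan _) (is_derive1_div g0 fa gb))).
have h : f t ^+ 2 + g t ^+ 2 != 0.
  by rewrite gt_eqF// ltr_wpDl ?sqr_ge0// exprn_even_gt0.
have -> : 1 + (f t / g t) ^+ 2 = (f t ^+ 2 + g t ^+ 2) / g t ^+ 2.
  by field.
by field; rewrite g0 h.
Qed.

Lemma is_derive1_quadratic f t c M delta : 0 < delta ->
  (forall h, `|h| < delta -> `|f (t + h) - f t - h * c| <= M * h ^+ 2) ->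
  is_derive t 1 f c.
Proof.
move=> delta0 hM.
have M0 : 0 <= M.
  have d2 : 0 < delta / 2 by rewrite divr_gt0.
  have dn : `|delta / 2| < delta by rewrite gtr0_norm//; lra.
  have := le_trans (normr_ge0 _) (hM _ dn).
  by rewrite pmulr_lge0// exprn_gt0.
have cvg : h^-1 *: (f (h *: 1 + t) - f t) @[h --> 0^'] --> c.
  apply/cvgrPdist_le => e e0; near=> h.
  have h0 : h != 0 by near: h; exact: nbhs_dnbhs_neq.
  have hd : `|h| < Num.min delta (e / (M + 1)).
    near: h; apply: dnbhs0_lt; rewrite lt_min delta0 divr_gt0// ltr_wpDl//.
  move: hd; rewrite lt_min => /andP[hd he].
  have := hM h hd; rewrite /GRing.scale/= mulr1 => hh.
  have -> : c - h^-1 * (f (h + t) - f t) = - (h^-1 * (f (t + h) - f t - h * c)).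
    by rewrite (addrC h); field.
  rewrite normrN normrM normfV ler_pdivrMl ?normr_gt0//.
  rewrite (le_trans hh)// -real_normK ?num_real// expr2 mulrCA ler_wpM2l//.
  rewrite (@le_trans _ _ ((M + 1) * `|h|))//; first by rewrite ler_wpM2r// lerDl.
  by rewrite mulrC -ler_pdivlMr ?ltr_wpDl// ltW.
by apply: DeriveDef; [apply/cvg_ex; exists c|apply/cvg_lim].
Unshelve. all: by end_near. Qed.

Lemma is_derive1_continuous f t a : is_derive t 1 f a -> {for t, continuous f}.
Proof. by move=> [df _]; apply/differentiable_continuous/derivable1_diffP. Qed.

Lemma derive0_segment_cst f a b : a <= b ->
  (forall t, a <= t <= b -> is_derive t 1 f 0) -> f a = f b.
Proof.
move=> ab df.
have [|t|c _] := @MVT_segment R f (fun=> 0) a b ab.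
- by move=> x; rewrite in_itv/= => /andP[ax xb]; apply: df; rewrite !ltW.
- apply: continuous_in_subspaceT => x; rewrite inE/= in_itv/= => /df.
  exact: is_derive1_continuous.
- by rewrite mul0r => /eqP; rewrite subr_eq0 eq_sym => /eqP.
Qed.

End DerivativeRules.

(** * Derivatives along segments *)

Section CauchyDerivative.
Context {R : realType} (mu : probability R R).
Implicit Types (W D : R[i]) (t s x : R).

Let G := cauchy_transform mu.
Let G2 := cauchy_transform2 mu.

Lemma ReMreal s D : complex.Re (s%:C * D) = s * complex.Re D.
Proof. by rewrite Re_mulc/= mul0r subr0. Qed.

Lemma ImMreal s D : complex.Im (s%:C * D) = s * complex.Im D.
Proof. by rewrite Im_mulc/= mul0r addr0. Qed.

Lemma Re_subc W D : complex.Re (W - D) = complex.Re W - complex.Re D.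
Proof. by case: W D => [a b] [a' b']. Qed.

Lemma Im_subc W D : complex.Im (W - D) = complex.Im W - complex.Im D.
Proof. by case: W D => [a b] [a' b']. Qed.

Lemma modulus_real x : modulus (x%:C : R[i]) = `|x|.
Proof. by rewrite /modulus/= expr0n/= addr0 sqrtr_sqr. Qed.

Lemma Im_segment_ge W D h : 0 < complex.Im W ->
  `|h| < complex.Im W / 2 / (1 + modulus D) ->
  complex.Im W / 2 <= complex.Im (W + h%:C * D).
Proof.
move=> W0 hd; have D1 : 0 < 1 + modulus D by rewrite ltr_pwDl// modulus_ge0.
rewrite (le_trans _ (Im_ge _ _))// modulusM modulus_real.
have : `|h| * modulus D <= complex.Im W / 2.
  rewrite ltr_pdivlMr// in hd; rewrite (le_trans _ (ltW hd))//.
  by rewrite ler_wpM2l// lerDr.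
by lra.
Qed.

Lemma cauchy_derivative_aux W D : 0 < complex.Im W ->
  exists M delta, 0 < delta /\ forall h, `|h| < delta ->
    modulus (G (W + h%:C * D) - G W - h%:C * (- D * G2 W)) <= M * h ^+ 2.
Proof.
move=> W0; have D1 : 0 < 1 + modulus D by rewrite ltr_pwDl// modulus_ge0.
have W2 : 0 < complex.Im W / 2 by rewrite divr_gt0.
exists (modulus D ^+ 2 * (2 * ((complex.Im W) ^- 2 * (complex.Im W / 2)^-1))).
exists (complex.Im W / 2 / (1 + modulus D)); split; first by rewrite divr_gt0.
move=> h hd; have hI := Im_segment_ge W0 hd.
have [c hc eG] := cauchy_taylor2 mu W0 (lt_le_trans W2 hI).
rewrite [G (W + _)]eG -/G -/G2.
have -> : G W - h%:C * D * G2 W + (h%:C * D) ^+ 2 * c - G W - h%:C * (- D * G2 W)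
  = h%:C ^+ 2 * (D ^+ 2 * c) by ring.
rewrite (modulusM (h%:C ^+ 2)) (modulusM (D ^+ 2)) !modulusX modulus_real real_normK ?num_real// mulrC.
rewrite ler_wpM2r ?sqr_ge0// ler_wpM2l ?exprn_ge0 ?modulus_ge0//.
rewrite (le_trans hc)// ler_wpM2l// ler_wpM2l ?invr_ge0 ?exprn_ge0 ?(ltW W0)//.
by rewrite lef_pV2 ?posrE// (lt_le_trans W2).
Qed.

Lemma segmentD W D t h :
  W + (t + h)%:C * D = W + t%:C * D + h%:C * D.
Proof. by rewrite rmorphD/= mulrDl addrA. Qed.

Lemma is_derive_Re_cauchy W D t : 0 < complex.Im (W + t%:C * D) ->
  is_derive t 1 (fun s => complex.Re (G (W + s%:C * D)))
    (complex.Re (- D * G2 (W + t%:C * D))).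
Proof.
move=> W0; have [M [d [d0 hM]]] := cauchy_derivative_aux D W0.
apply: (@is_derive1_quadratic _ _ _ _ M _ d0) => h hd.
rewrite segmentD (le_trans _ (hM h hd))//.
by rewrite (le_trans _ (normr_Re _))// !Re_subc ReMreal.
Qed.

Lemma is_derive_Im_cauchy W D t : 0 < complex.Im (W + t%:C * D) ->
  is_derive t 1 (fun s => complex.Im (G (W + s%:C * D)))
    (complex.Im (- D * G2 (W + t%:C * D))).
Proof.
move=> W0; have [M [d [d0 hM]]] := cauchy_derivative_aux D W0.
apply: (@is_derive1_quadratic _ _ _ _ M _ d0) => h hd.
rewrite segmentD (le_trans _ (hM h hd))//.
by rewrite (le_trans _ (normr_Im _))// !Im_subc ImMreal.
Qed.

(** Strictness matters, as the argument of [G] is computed from [Re G / Im G]: were the integral of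
    the positive function [f] zero, [f] would vanish almost everywhere and the whole line would be
    null. *)
Lemma Im_cauchy_lt0 W : 0 < complex.Im W -> complex.Im (G W) < 0.
Proof.
move=> W0; pose f x := - complex.Im (resolvent W x).
have fE x : f x = complex.Im W / ((complex.Re W - x) ^+ 2 + complex.Im W ^+ 2).
  by rewrite /f resolventE/= opprK.
have f0 x : 0 < f x.
  by rewrite fE divr_gt0// ltr_wpDl ?sqr_ge0// exprn_gt0.
have [_ mI [M hM]] := bounded_mfun_resolvent W0.
have mf : measurable_fun setT f by exact: measurableT_comp.
have fM x : `|f x| <= M by rewrite normrN (le_trans (normr_Im _)).
have fi : mu.-integrable setT (EFin \o f) by exact: bounded_integrable fM.
have -> : complex.Im (G W) = - Rintegral mu setT f.
  rewrite -[RHS]mulN1r -RintegralZl//; apply: eq_Rintegral => x _.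
  by rewrite mulN1r opprK.
rewrite oppr_lt0 lt_neqAle Rintegral_ge0; last by move=> x _; exact/ltW/f0.
rewrite andbT; apply/eqP => If0.
have int0 : (\int[mu]_(x in setT) `|(EFin \o f) x| = 0)%E.
  rewrite -[RHS](_ : (Rintegral mu setT f)%:E = 0%E); last by rewrite -If0.
  rewrite /Rintegral fineK; last exact: integrable_fin_num.
  by apply: eq_integral => x _ /=; rewrite gtr0_norm.
move/(ae_eq_integral_abs mu measurableT) : int0 => /(_ (measurable_int _ fi)).
case=> N [mN N0 hN].
have : (mu setT <= mu N)%E.
  apply: le_measure; rewrite ?inE// => x _; apply: hN => /= /(_ I) [fx0].
  by have := f0 x; rewrite fx0 ltxx.
by rewrite N0 probability_setT leNgt lte_fin ltr01.
Qed.

(* The expectation of the argument of [W - X]. *)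
Definition mean_arg W : R :=
  Rintegral mu setT (fun x => pi / 2 - atan ((complex.Re W - x) / complex.Im W)).

Lemma arg_bounds (r : R) : 0 <= pi / 2 - atan r <= pi.
Proof.
have := atan_gtNpi2 r; have := atan_ltpi2 r.
by move=> h1 h2; apply/andP; split; lra.
Qed.

Lemma integrable_arg W :
  mu.-integrable setT (EFin \o (fun x => pi / 2 - atan ((complex.Re W - x) / complex.Im W))).
Proof.
apply: (@bounded_integrable _ _ _ _ _ pi) => [|x].
  apply: measurable_funB => //.
  apply: measurableT_comp.
    by apply: continuous_measurable_fun => x; exact: continuous_atan.
  by apply: measurable_funM => //; exact: measurable_funB.
have /andP[h0 h1] := arg_bounds ((complex.Re W - x) / complex.Im W).
by rewrite ger0_norm.
Qed.

Lemma mean_arg_bounds W : 0 <= mean_arg W <= pi.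
Proof.
apply/andP; split.
  by apply: Rintegral_ge0 => x _; have /andP[] := arg_bounds ((complex.Re W - x) / complex.Im W).
rewrite (_ : pi = Rintegral mu setT (cst pi)); last first.
  by rewrite Rintegral_cst// (congr1 (fun e => pi * fine e) (probability_setT mu)) mulr1.
apply: le_Rintegral => //; first exact: integrable_arg.
  exact: finite_measure_integrable_cst.
by move=> x _; have /andP[] := arg_bounds ((complex.Re W - x) / complex.Im W).
Qed.

Lemma is_derive_segment (c a t : R) : is_derive t 1 (fun s : R => c + s * a) a.
Proof.
apply: (is_derive_eq (is_derive1D (is_derive1_cst c t)
  (is_derive1M (is_derive1_id t) (is_derive1_cst a t)))).
by rewrite mulr0 addr0 add0r mul1r.
Qed.

Lemma is_derive_Re_segment W D t :
  is_derive t 1 (fun s => complex.Re (W + s%:C * D)) (complex.Re D).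
Proof.
rewrite (_ : (fun s => _) = (fun s => complex.Re W + s * complex.Re D)).
  exact: is_derive_segment.
by apply/funext => s; rewrite raddfD/= ReMreal.
Qed.

Lemma is_derive_Im_segment W D t :
  is_derive t 1 (fun s => complex.Im (W + s%:C * D)) (complex.Im D).
Proof.
rewrite (_ : (fun s => _) = (fun s => complex.Im W + s * complex.Im D)).
  exact: is_derive_segment.
by apply/funext => s; rewrite raddfD/= ImMreal.
Qed.

(** The argument of [W - x] is the imaginary part of its logarithm, with derivative
    [Im (D / (W - x))] in the direction [D]. Near [t] the ordinate stays above half its value, which
    bounds this derivative uniformly in [x]. *)
Lemma is_derive_mean_arg W D t : 0 < complex.Im (W + t%:C * D) ->
  is_derive t 1 (fun s => mean_arg (W + s%:C * D))
    (complex.Im (D * G (W + t%:C * D))).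
Proof.
set Wt := W + _ => W0.
pose delta := complex.Im Wt / 2 / (1 + modulus D).
have D1 : 0 < 1 + modulus D by rewrite ltr_pwDl// modulus_ge0.
have W2 : 0 < complex.Im Wt / 2 by rewrite divr_gt0.
have d0 : 0 < delta by rewrite divr_gt0.
have Is s : s \in `]t - delta, t + delta[ -> complex.Im Wt / 2 <= complex.Im (W + s%:C * D).
  rewrite in_itv/= => /andP[s1 s2].
  have -> : s = t + (s - t) by rewrite addrC subrK.
  rewrite segmentD; apply: Im_segment_ge => //.
  by rewrite ltr_norml; apply/andP; split; rewrite -/delta; lra.
pose f s x := pi / 2 - atan ((complex.Re (W + s%:C * D) - x) / complex.Im (W + s%:C * D)).
have df s x : 0 < complex.Im (W + s%:C * D) ->
    is_derive s 1 (f^~ x) (complex.Im (D * resolvent (W + s%:C * D) x)).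
  move=> I0.
  have I0' : complex.Im (W + s%:C * D) != 0 by rewrite gt_eqF.
  have dR := is_derive1B (is_derive_Re_segment W D s) (is_derive1_cst x s).
  have := is_derive1_atan_div I0' dR (is_derive_Im_segment W D s).
  move=> /(is_derive1B (is_derive1_cst (pi / 2) s)) H.
  apply: (is_derive_eq H); rewrite resolventE Im_mulc/= subr0 sub0r.
  set A := complex.Re (W + _); set B := complex.Im (W + _).
  have h : (A - x) ^+ 2 + B ^+ 2 != 0.
    by rewrite gt_eqF// ltr_wpDl ?sqr_ge0// exprn_gt0.
  by clearbody A B; field.
have tI : t \in `]t - delta, t + delta[ by rewrite in_itv/=; apply/andP; split; lra.
have pE s x : s \in `]t - delta, t + delta[ ->
    partial1of2 f s x = complex.Im (D * resolvent (W + s%:C * D) x).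
  move=> /Is sI; rewrite partial1of2E.
  by have [_ ->] := df s x (lt_le_trans W2 sI).
pose C := modulus D * (complex.Im Wt / 2)^-1.
have H1 x : `](t - delta), (t + delta)[%classic x ->
    mu.-integrable setT (EFin \o f x) by move=> _; exact: integrable_arg.
have H2 x y : `](t - delta), (t + delta)[%classic x -> setT y -> derivable (f ^~ y) x 1.
  by move=> /= /Is xI _; have [] := df x y (lt_le_trans W2 xI).
have H3 (y : R) : 0 <= (cst C : R -> R) y.
  by rewrite mulr_ge0 ?modulus_ge0// invr_ge0 ltW.
have H4 : mu.-integrable setT (EFin \o (cst C : R -> R)).
  exact: finite_measure_integrable_cst.
have H5 x y : `](t - delta), (t + delta)[%classic x -> setT y ->
    `|partial1of2 f x y| <= (cst C : R -> R) y.
  move=> /= xI _; rewrite pE// (le_trans (normr_Im _))// modulusM ler_wpM2l ?modulus_ge0//.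
  have xI' := lt_le_trans W2 (Is _ xI).
  by rewrite (le_trans (modulus_resolvent _ xI'))// lef_pV2 ?posrE// Is.
have H := differentiation_under_integral measurableT tI H1 H2 H3 H4 H5.
have H' := derivable_under_integral measurableT tI H1 H2 H3 H4 H5.
apply: DeriveDef; first exact: H'.
rewrite -derive1E; rewrite /= in H.
rewrite [LHS]H /G /cauchy_transform -CintegralZ; last exact: bounded_mfun_resolvent.
by rewrite /=; apply: eq_Rintegral => x _; rewrite pE.
Qed.

End CauchyDerivative.

(** * First integrals of the differential equation *)

Section CauchyFirstIntegrals.
Context {R : realType}.
Implicit Types (f g : R -> R) (t p q : R).

(* [E1 + i E2 = (1 - G) G' + D G^2] for [G = f + i g] and [D = p + i q]. The
   three functions are the real and imaginary parts of [1/G + log G - W] and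
   [m - Im (G - log G)], where [m' = Im (D G)]; the argument of [G] is
   [- (pi / 2 + atan (f / g))] because [g < 0]. *)
Section ode.
Variables (f g r v m : R -> R) (t df dg p q : R).
Hypotheses (f' : is_derive t 1 f df) (g' : is_derive t 1 g dg) (g0 : g t < 0).
Hypotheses (r' : is_derive t 1 r p) (v' : is_derive t 1 v q).
Hypothesis m' : is_derive t 1 m (p * g t + q * f t).
Hypothesis E1 : df * (1 - f t) + dg * g t + p * (f t ^+ 2 - g t ^+ 2)
  - 2 * q * f t * g t = 0.
Hypothesis E2 : dg * (1 - f t) - df * g t + 2 * p * f t * g t
  + q * (f t ^+ 2 - g t ^+ 2) = 0.

Let g_neq0 : g t != 0. Proof. by rewrite lt_eqF. Qed.
Let n s := f s ^+ 2 + g s ^+ 2.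
Let N_gt0 : 0 < n t.
Proof. by rewrite ltr_wpDl ?sqr_ge0// exprn_even_gt0. Qed.
Let N_neq0 : n t != 0. Proof. by rewrite gt_eqF. Qed.

Let N' : is_derive t 1 n (2 * (f t * df + g t * dg)).
Proof.
apply: (is_derive_eq (is_derive1D (is_derive1M f' f') (is_derive1M g' g'))).
by ring.
Qed.

Lemma first_integral_Re :
  is_derive t 1 (fun s => f s / (f s ^+ 2 + g s ^+ 2)
     + ln (f s ^+ 2 + g s ^+ 2) / 2 - r s) 0.
Proof.
have lnN := is_derive1M (is_derive1_lnf N_gt0 N') (is_derive1_cst 2^-1 t).
apply: (is_derive_eq (is_derive1B (is_derive1D (is_derive1_div N_neq0 f' N') lnN) r')).
(* The derivative of [1/G + log G - W] is [- (E1 + i E2) / G^2]. Multiplying above and below by the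
   square of the conjugate of [G] gives this real part, and in the next lemma the imaginary part. *)
transitivity (- ((f t ^+ 2 - g t ^+ 2) * (df * (1 - f t) + dg * g t +
  p * (f t ^+ 2 - g t ^+ 2) - 2 * q * f t * g t) +
  2 * f t * g t * (dg * (1 - f t) - df * g t + 2 * p * f t * g t
  + q * (f t ^+ 2 - g t ^+ 2))) / (f t ^+ 2 + g t ^+ 2) ^+ 2).
  by rewrite /n; field.
by rewrite E1 E2; ring.
Qed.

Lemma first_integral_Im :
  is_derive t 1 (fun s => - (g s / (f s ^+ 2 + g s ^+ 2))
     - (pi / 2 + atan (f s / g s)) - v s) 0.
Proof.
have at' := is_derive1D (is_derive1_cst (pi / 2) t) (is_derive1_atan_div g_neq0 f' g').
apply: (is_derive_eq (is_derive1B (is_derive1B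
  (is_derive1N (is_derive1_div N_neq0 g' N')) at') v')).
transitivity (- ((f t ^+ 2 - g t ^+ 2) * (dg * (1 - f t) - df * g t + 2 * p * f t * g t
  + q * (f t ^+ 2 - g t ^+ 2)) -
  2 * f t * g t * (df * (1 - f t) + dg * g t +
  p * (f t ^+ 2 - g t ^+ 2) - 2 * q * f t * g t)) / (f t ^+ 2 + g t ^+ 2) ^+ 2).
  by rewrite /n; field.
by rewrite E1 E2; ring.
Qed.

Lemma first_integral_arg :
  is_derive t 1 (fun s => m s - (pi / 2 + atan (f s / g s)) - g s) 0.
Proof.
have at' := is_derive1D (is_derive1_cst (pi / 2) t) (is_derive1_atan_div g_neq0 f' g').
apply: (is_derive_eq (is_derive1B (is_derive1B m' at') g')).
(* This is the imaginary part of [(E1 + i E2) / G]. *)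
transitivity ((f t * (dg * (1 - f t) - df * g t + 2 * p * f t * g t
  + q * (f t ^+ 2 - g t ^+ 2)) -
  g t * (df * (1 - f t) + dg * g t +
  p * (f t ^+ 2 - g t ^+ 2) - 2 * q * f t * g t)) / (f t ^+ 2 + g t ^+ 2)).
  by rewrite /n; field.
by rewrite E1 E2; ring.
Qed.

End ode.
End CauchyFirstIntegrals.

Lemma ode_split {R : rcfType} (h g D : R[i]) : h * (1 - g) + D * g ^+ 2 = 0 ->
  let a := complex.Re g in let c := complex.Im g in
  let dh := complex.Re h in let dg := complex.Im h in
  let p := complex.Re D in let q := complex.Im D in
  dh * (1 - a) + dg * c + p * (a ^+ 2 - c ^+ 2) - 2 * q * a * c = 0 /\
  dg * (1 - a) - dh * c + 2 * p * a * c + q * (a ^+ 2 - c ^+ 2) = 0.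
Proof.
case: h g D => [dh dg] [a c] [p q]; rewrite expr2 => /eqP.
by rewrite eq_complex/= => /andP[/eqP h1 /eqP h2]; split;
  [rewrite -[RHS]h1|rewrite -[RHS]h2]; ring.
Qed.

(* The abscissa of the point [z - Log z] of ordinate [eps], where [z] has
   argument [t], hence [Im z = t + eps]. *)
Definition boundary_curve {R : realType} (eps t : R) : R :=
  (t + eps) * cos t / sin t + ln (sin t / (t + eps)).

(** * Solving the equation in polar coordinates *)

Section CauchyParametrization.
Context {R : realType} (mu : probability R R).
Implicit Types (W D : R[i]) (x t s : R).

Let G := cauchy_transform mu.
Let G2 := cauchy_transform2 mu.

Variable b : R.
Hypothesis b_ge2 : 2 <= b.
Hypothesis GE : forall y, b < y -> G (log_curve y) = (0 +i* y)^-1.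

Let g1 W := complex.Re (G W).
Let g2 W := complex.Im (G W).
Let N W := g1 W ^+ 2 + g2 W ^+ 2.
Let psi1 W := g1 W / N W + ln (N W) / 2 - complex.Re W.
Let psi2 W := - (g2 W / N W) - (pi / 2 + atan (g1 W / g2 W)) - complex.Im W.
Let psi3 W := mean_arg mu W - (pi / 2 + atan (g1 W / g2 W)) - g2 W.

Let psi_segment W D t : 0 < complex.Im (W + t%:C * D) ->
  [/\ is_derive t 1 (fun s => psi1 (W + s%:C * D)) 0,
      is_derive t 1 (fun s => psi2 (W + s%:C * D)) 0 &
      is_derive t 1 (fun s => psi3 (W + s%:C * D)) 0].
Proof.
move=> W0.
have f' := is_derive_Re_cauchy mu W0.
have g' := is_derive_Im_cauchy mu W0.
have m' := is_derive_mean_arg mu W0.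
have r' := is_derive_Re_segment W D t.
have v' := is_derive_Im_segment W D t.
have g0 := Im_cauchy_lt0 mu W0.
have := cauchy_ode b_ge2 GE W0; rewrite -/G -/G2 => K.
rewrite -/G -/G2 in f' g' m' g0.
pose g := - D * G2 (W + t%:C * D).
have : g * (1 - G (W + t%:C * D)) + D * G (W + t%:C * D) ^+ 2 = 0.
  by rewrite -K /g; ring.
rewrite -/g in f' g'; rewrite Im_mulc in m'.
move=> /ode_split[E1 E2].
split.
- exact: (first_integral_Re f' g' g0 r' E1 E2).
- exact: (first_integral_Im f' g' g0 v' E1 E2).
- exact: (first_integral_arg f' g' g0 m' E1 E2).
Qed.

Let psi_cst W W' : 0 < complex.Im W -> 0 < complex.Im W' ->
  [/\ psi1 W = psi1 W', psi2 W = psi2 W' & psi3 W = psi3 W'].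
Proof.
move=> W0 W0'; pose D := W' - W.
have DI t : 0 <= t <= 1 -> 0 < complex.Im (W + t%:C * D).
  move=> /andP[t0 t1]; rewrite raddfD/= ImMreal /D Im_subc.
  have -> : complex.Im W + t * (complex.Im W' - complex.Im W) =
    (1 - t) * complex.Im W + t * complex.Im W' by ring.
  have [->|tn0] := eqVneq t 0; first by rewrite subr0 mul1r mul0r addr0.
  rewrite ltr_wpDl ?mulr_ge0 ?(ltW W0) ?subr_ge0//.
  by rewrite mulr_gt0// lt_neqAle eq_sym tn0.
have e0 : W + 0%:C * D = W by rewrite mul0r addr0.
have e1 : W + 1%:C * D = W' by rewrite mul1r /D addrC subrK.
have H f : (forall t, 0 <= t <= 1 -> is_derive t 1 (fun s => f (W + s%:C * D)) 0) ->
    f W = f W' :> R.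
  by move=> /(derive0_segment_cst ler01); rewrite e0 e1.
by split; apply: H => t /DI /psi_segment[].
Qed.

Let base : R := b + 1.

Let base_gt : b < base. Proof. by rewrite ltrDl. Qed.

(** On the curve [W = z - Log z] and [G = 1 / z], so [1/G + log G - W] vanishes there. *)
Let psi_base : psi1 (log_curve base) = 0 /\ psi2 (log_curve base) = 0.
Proof.
have B0 : 0 < base by rewrite (lt_trans _ base_gt)// (lt_le_trans _ b_ge2).
have Bn0 : base != 0 by rewrite gt_eqF.
have GB : G (log_curve base) = 0 +i* (- base^-1).
  rewrite GE//; apply/eqP; rewrite eq_complex/=; apply/andP.
  by split; apply/eqP; field.
rewrite /psi1 /psi2 /N /g1 /g2 GB/=; split.
  rewrite mul0r add0r opprK expr0n/= add0r sqrrN lnXn ?invr_gt0//.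
  by rewrite lnV ?posrE// mulNrn -mulr_natr; field.
by rewrite mul0r atan0 addr0 expr0n/= add0r; field.
Qed.

(** The parameter [t] is the argument of [z = 1 / G W]. The imaginary part of [z - Log z = W] gives
    [Im z = t + Im W], so [|z| = (t + Im W) / sin t], and the real part gives the abscissa. Since
    [Im G = - sin^2 t / (t + Im W)], the third first integral gives [mean_arg] up to [C], its
    unknown value at the base point. *)
Lemma cauchy_parametrization : exists C, forall W, 0 < complex.Im W ->
  exists t, [/\ 0 < t < pi, complex.Re W = boundary_curve (complex.Im W) t &
    mean_arg mu W = t - sin t ^+ 2 / (t + complex.Im W) + C].
Proof.
exists (psi3 (log_curve base)) => W W0.
have [p1 p2 p3] := psi_cst W0 (log_curve_Im b_ge2 base_gt).
have [b1 b2] := psi_base.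
have g20 : g2 W < 0 by exact: Im_cauchy_lt0.
pose phi := atan (g1 W / g2 W); pose t := phi + pi / 2.
have phi1 : - (pi / 2) < phi by exact: atan_gtNpi2.
have phi2 : phi < pi / 2 by exact: atan_ltpi2.
have t0p : 0 < t < pi by apply/andP; split; rewrite /t; lra.
have st : sin t = cos phi by rewrite /t sinDpihalf.
have ct : cos t = - sin phi by rewrite /t cosDpihalf.
have s0 : 0 < sin t by exact: sin_gt0_pi.
have N0 : 0 < N W by rewrite /N ltr_wpDl ?sqr_ge0// exprn_even_gt0//= lt_eqF.
have tanE : g1 W * sin t = - g2 W * cos t.
  have : tan phi = g1 W / g2 W by rewrite atanK.
  rewrite /tan st ct => h.
  have -> : g1 W = sin phi / cos phi * g2 W by rewrite h divfK// lt_eqF.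
  by field; rewrite -st gt_eqF.
have NE : N W * sin t ^+ 2 = g2 W ^+ 2.
  have -> : N W * sin t ^+ 2 = (g1 W * sin t) ^+ 2 + g2 W ^+ 2 * sin t ^+ 2.
    by rewrite /N; ring.
  by rewrite tanE -[RHS]mulr1 -(cos2Dsin2 t); ring.
have bE : t + complex.Im W = - (g2 W / N W).
  by move: p2; rewrite b2 /psi2 -/phi /t; lra.
set B := t + complex.Im W in bE *.
have B0 : 0 < B by rewrite /B addr_gt0//; move/andP: t0p => [].
have g2E : g2 W = - (B * N W) by rewrite bE mulNr divfK ?opprK// gt_eqF.
have NE2 : N W = (sin t / B) ^+ 2.
  apply/(mulfI (lt0r_neq0 N0))/eqP.
  move: NE; rewrite g2E => /eqP NE.
  have {}NE : N W * sin t ^+ 2 = B ^+ 2 * (N W * N W) by rewrite (eqP NE); ring.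
  apply/eqP; rewrite [RHS](_ : _ = N W * sin t ^+ 2 / B ^+ 2).
    by rewrite NE; field; rewrite gt_eqF.
  by field; rewrite gt_eqF.
exists t; split => //.
- have : complex.Re W = g1 W / N W + ln (N W) / 2.
    by move: p1; rewrite b1 /psi1 => /eqP; rewrite subr_eq0 => /eqP <-.
  rewrite [in ln _]NE2 lnXn ?divr_gt0// -/B => ->.
  rewrite /boundary_curve -/B -mulr_natr; congr (_ + _); last by field.
  have g1E : g1 W = B * N W * cos t / sin t.
    rewrite -[LHS](mulfK (lt0r_neq0 s0)) tanE g2E opprK//.
  by rewrite g1E; field; rewrite !gt_eqF.
- have h3 : mean_arg mu W = t + g2 W + psi3 W.
    by rewrite /psi3 -/phi /t; ring.
  rewrite -p3 h3; congr (_ + _ + _).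
  by rewrite g2E NE2 -/B; field; rewrite gt_eqF.
Qed.

End CauchyParametrization.

(** * The distribution function of the free stable law *)

Section BoundaryCurve.
Context {R : realType}.
Implicit Types (eps t x : R).

(** The numerator [(t + eps)^2 - 2 (t + eps) sin t cos t + sin^2 t] is written as a sum of two
    squares to display the sign of the derivative. *)
Lemma is_derive_boundary_curve eps t : 0 <= eps -> 0 < t < pi ->
  is_derive t 1 (boundary_curve eps)
    (- (((t + eps) - sin t * cos t) ^+ 2 + sin t ^+ 4) / ((t + eps) * sin t ^+ 2)).
Proof.
move=> e0 /[dup] tpi /andP[t0 _].
have s0 : 0 < sin t by exact: sin_gt0_pi.
have B0 : 0 < t + eps by rewrite ltr_wpDr.
have Bn0 : t + eps != 0 by rewrite gt_eqF.
have sn0 : sin t != 0 by rewrite gt_eqF.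
have q0 : 0 < sin t / (t + eps) by rewrite divr_gt0.
have dB := is_derive1D (is_derive1_id t) (is_derive1_cst eps t).
have dl := is_derive1_lnf (f := fun t => sin t / (t + eps)) q0
  (is_derive1_div (g := fun t => t + eps) Bn0 (is_derive_sin t) dB).
have dc := is_derive1_div (f := fun t => (t + eps) * cos t) sn0
  (is_derive1M dB (is_derive_cos t)) (is_derive_sin t).
apply: (is_derive_eq (is_derive1D dc dl)).
transitivity (- ((t + eps) ^+ 2 * (cos t ^+ 2 + sin t ^+ 2) -
   2 * (t + eps) * sin t * cos t + sin t ^+ 2) / ((t + eps) * sin t ^+ 2)).
  by field; rewrite sn0 Bn0.
have -> : sin t ^+ 4 = sin t ^+ 2 * (cos t ^+ 2 + sin t ^+ 2) - (sin t * cos t) ^+ 2.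
  by ring.
by rewrite cos2Dsin2; congr (- _ / _); ring.
Qed.

Lemma boundary_curve_decr eps t1 t2 : 0 <= eps -> 0 < t1 -> t1 < t2 -> t2 < pi ->
  boundary_curve eps t2 < boundary_curve eps t1.
Proof.
move=> e0 t10 t12 t2pi.
have tI x : t1 <= x <= t2 -> 0 < x < pi.
  by move=> /andP[x1 x2]; rewrite (lt_le_trans t10)//= (le_lt_trans x2).
have [||c] := @MVT R (boundary_curve eps)
  (fun t => - (((t + eps) - sin t * cos t) ^+ 2 + sin t ^+ 4) / ((t + eps) * sin t ^+ 2))
  t1 t2 t12.
- move=> x; rewrite in_itv/= => /andP[x1 x2].
  by apply: is_derive_boundary_curve => //; apply: tI; rewrite !ltW.
- apply: continuous_in_subspaceT => x; rewrite inE/= in_itv/= => /tI xI.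
  exact: is_derive1_continuous (is_derive_boundary_curve e0 xI).
- rewrite in_itv/= => /andP[c1 c2] cE.
  have /andP[c0 cpi] : 0 < c < pi by apply: tI; rewrite !ltW.
  have sc0 : 0 < sin c by apply: sin_gt0_pi; rewrite c0.
  rewrite -subr_lt0 cE pmulr_llt0 ?subr_gt0// mulNr oppr_lt0 divr_gt0//.
    by rewrite ltr_wpDl ?sqr_ge0// exprn_gt0.
  by rewrite mulr_gt0 ?exprn_gt0// ltr_wpDr.
Qed.

Lemma boundary_curve_inj eps t1 t2 : 0 <= eps -> 0 < t1 < pi -> 0 < t2 < pi ->
  boundary_curve eps t1 = boundary_curve eps t2 -> t1 = t2.
Proof.
move=> e0 /andP[a1 b1] /andP[a2 b2] e12; have [h|h|//] := ltgtP t1 t2.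
  by have := boundary_curve_decr e0 a1 h b2; rewrite e12 ltxx.
by have := boundary_curve_decr e0 a2 h b1; rewrite e12 ltxx.
Qed.

Lemma boundary_curve_cvg t : 0 < t < pi ->
  boundary_curve n.+1%:R^-1 t @[n --> \oo] --> boundary_curve 0 t.
Proof.
move=> /[dup] tpi /andP[t0 _].
have s0 : 0 < sin t by exact: sin_gt0_pi.
have dB := is_derive1D (is_derive1_cst t 0) (is_derive1_id (0 : R)).
have n0 : t + 0 != 0 by rewrite addr0 gt_eqF.
have q0 : 0 < sin t / (t + 0) by rewrite addr0 divr_gt0.
have dl := is_derive1_lnf (f := fun e => sin t / (t + e)) q0
  (is_derive1_div (g := fun e => t + e) n0 (is_derive1_cst (sin t) 0) dB).
have dc := is_derive1M (is_derive1M dB (is_derive1_cst (cos t) 0)) (is_derive1_cst (sin t)^-1 0).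
have := is_derive1_continuous (is_derive1D dc dl).
by move=> H; exact: (cvg_comp _ _ (@cvg_harmonic R) H).
Qed.

Lemma sin_le x : 0 <= x -> sin x <= x.
Proof.
rewrite le_eqVlt => /predU1P[<-|x0]; first by rewrite sin0.
have cs : {within `[0, x], continuous (@sin R)}.
  by apply: continuous_subspaceT => y; exact: continuous_sin.
have [c _] := MVT x0 (fun y _ => is_derive_sin y) cs.
by rewrite sin0 !subr0 => ->; rewrite ler_piMl ?(ltW x0)// cos_le1.
Qed.

Lemma tcos_le_sin t : 0 < t < pi -> t * cos t <= sin t.
Proof.
move=> /andP[t0 tpi].
pose f x := sin x - x * cos x; pose df (x : R) := x * sin x.
have f' (x : R) : is_derive x 1 f (df x).
  apply: (is_derive_eq (is_derive1B (is_derive_sin x)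
    (is_derive1M (is_derive1_id x) (is_derive_cos x)))).
  by rewrite /df; ring.
have cf : {within `[0, t], continuous f}.
  by apply: continuous_subspaceT => y; exact: is_derive1_continuous (f' y).
have [c] := MVT t0 (fun y _ => f' y) cf.
rewrite in_itv/= => /andP[c0 ct].
rewrite {2}/f sin0 mul0r !subr0 => fE; rewrite -subr_ge0 -/(f t) fE.
by rewrite !mulr_ge0 ?(ltW c0) ?(ltW t0)// ltW// sin_gt0_pi// c0 (lt_trans ct).
Qed.

(** The value 1 is the limit at [t = 0]; it bounds the support of the free stable law from above and
    corresponds to the end point [e] of the exponential law. *)
Lemma boundary_curve_le1 t : 0 < t < pi -> boundary_curve 0 t <= 1.
Proof.
move=> /[dup] tpi /andP[t0 _]; rewrite /boundary_curve addr0.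
have s0 : 0 < sin t by exact: sin_gt0_pi.
rewrite -[1]addr0 lerD// ?ler_pdivrMr ?mul1r ?tcos_le_sin//.
by rewrite ln_le0// ler_pdivrMr// mul1r sin_le// ltW.
Qed.

Definition boundary_ccdf t : R := t - sin t ^+ 2 / t.

Lemma is_derive_boundary_ccdf t : 0 < t ->
  is_derive t 1 boundary_ccdf
    (1 - 2 * sin t * cos t / t + sin t ^+ 2 / t ^+ 2).
Proof.
move=> t0; have tn0 : t != 0 by rewrite gt_eqF.
have ds := is_derive1M (is_derive_sin t) (is_derive_sin t).
apply: (is_derive_eq (is_derive1B (is_derive1_id t)
  (is_derive1_div (g := id) tn0 ds (is_derive1_id t)))).
by field.
Qed.

Lemma boundary_ccdf_le t : 0 < t -> boundary_ccdf t <= t.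
Proof. by move=> t0; rewrite gerBl divr_ge0 ?sqr_ge0// ltW. Qed.

End BoundaryCurve.

(** * Boundary values of the argument and tail probabilities *)

Section Distribution.
Context {R : realType} (mu : probability R R).
Implicit Types (eps t x : R).

Lemma Rintegral_indicZ (a : R) (E : set R) : measurable E ->
  mu.-integrable setT (EFin \o (fun x => a * \1_E x)) /\
  Rintegral mu setT (fun x => a * \1_E x) = a * fine (mu E).
Proof.
move=> mE; have iE : mu.-integrable setT (EFin \o (\1_E : R -> R)).
  exact: integrable_indic.
split; first exact: integrableMl_cst.
rewrite RintegralZl//; congr (_ * _).
by rewrite /Rintegral integral_indic// setIT.
Qed.

(** The argument of [W - x] increases with [x], from 0 to [pi]. As [Im W] tends to 0 it becomes [pi]
    for [x > Re W] and 0 for [x < Re W]; this bound and the next one turn [mean_arg] into [pi] times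
    a tail probability. *)
Lemma mean_arg_ge (W : R[i]) x0 (a : R) : 0 < complex.Im W -> 0 <= a ->
  a <= pi / 2 - atan ((complex.Re W - x0) / complex.Im W) ->
  a * fine (mu `[x0, +oo[%classic) <= mean_arg mu W.
Proof.
move=> W0 a0 ha.
have [i1 <-] := @Rintegral_indicZ a `[x0, +oo[%classic (measurable_itv _).
apply: le_Rintegral => //; first exact: integrable_arg.
move=> x _; rewrite indicE; case: (boolP (x \in _)) => [|_].
  rewrite inE/= in_itv/= andbT mulr1 => xx; rewrite (le_trans ha)// lerB// le_atan//.
  by rewrite ler_pM2r ?invr_gt0// lerB.
by rewrite mulr0; have /andP[] := arg_bounds ((complex.Re W - x) / complex.Im W).
Qed.

Lemma mean_arg_le (W : R[i]) x0 (a : R) : 0 < complex.Im W -> 0 <= a ->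
  pi / 2 - atan ((complex.Re W - x0) / complex.Im W) <= a ->
  mean_arg mu W <= a + pi * fine (mu `]x0, +oo[%classic).
Proof.
move=> W0 a0 ha.
have [i1 <-] := @Rintegral_indicZ pi `]x0, +oo[%classic (measurable_itv _).
have i2 : mu.-integrable setT (EFin \o cst a) by exact: finite_measure_integrable_cst.
have -> : a = Rintegral mu setT (cst a).
  by rewrite Rintegral_cst// (congr1 (fun e => a * fine e) (probability_setT mu)) mulr1.
rewrite -RintegralD//; apply: le_Rintegral => //; first exact: integrable_arg.
  exact: (integrableD measurableT i2 i1).
move=> x _; rewrite indicE; case: (boolP (x \in _)) => [_|].
  rewrite mulr1 ler_wpDl//.
  by have /andP[] := arg_bounds ((complex.Re W - x) / complex.Im W).
rewrite notin_setE/= in_itv/= andbT => /negP; rewrite -leNgt => xx.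
rewrite mulr0 addr0 (le_trans _ ha)// lerB// le_atan//.
by rewrite ler_pM2r ?invr_gt0// lerB.
Qed.

Variable b : R.
Hypothesis b_ge2 : 2 <= b.
Hypothesis GE : forall y, b < y -> cauchy_transform mu (log_curve y) = (0 +i* y)^-1.

(** Injectivity of [boundary_curve] identifies the parameter. As [mean_arg] lies in [[0, pi]], the
    formula at height 1 gives [C <= 0] when [t] tends to [pi] and [0 <= C] when [t] tends to 0. *)
Lemma mean_arg_boundary eps t : 0 < eps -> 0 < t < pi ->
  mean_arg mu (boundary_curve eps t +i* eps) = t - sin t ^+ 2 / (t + eps).
Proof.
have [C HC] := cauchy_parametrization b_ge2 GE.
have H e s : 0 < e -> 0 < s < pi ->
    mean_arg mu (boundary_curve e s +i* e) = s - sin s ^+ 2 / (s + e) + C.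
  move=> e0 spi; have [s' [s'pi /= hs ->]] := HC (boundary_curve e s +i* e) e0.
  by rewrite (boundary_curve_inj (ltW e0) s'pi spi (esym hs)).
suff C0 : C = 0 by move=> e0 tpi; rewrite H// C0 addr0.
have pi0 := pi_gt0 R.
have H0 s : 0 < s < pi -> 0 <= s - sin s ^+ 2 / (s + 1) + C <= pi.
  by move=> spi; rewrite -H// mean_arg_bounds.
apply/eqP; rewrite eq_le; apply/andP; split.
  apply/ler_addgt0Pl => e e0; rewrite addr0.
  pose d := Num.min (e / 2) (pi / 2).
  have d0 : 0 < d by rewrite lt_min !divr_gt0.
  have dpi : d <= pi / 2 by rewrite ge_min lexx orbT.
  have de : d <= e / 2 by rewrite ge_min lexx.
  have spi : 0 < pi - d < pi by apply/andP; split; lra.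
  have /andP[_ h] := H0 _ spi.
  have : sin (pi - d) ^+ 2 / (pi - d + 1) <= d.
    have s1 : sin (pi - d) <= d by rewrite sinB sinpi cospi mul0r sub0r mulN1r opprK sin_le// ltW.
    have s2 : 0 <= sin (pi - d) by rewrite ltW// sin_gt0_pi.
    rewrite ler_pdivrMr; last by lra.
    rewrite (@le_trans _ _ (d * 1))//.
      by rewrite expr2 ler_pM// sin_le1.
    by rewrite ler_wpM2l ?(ltW d0)//; lra.
  by lra.
apply/ler_addgt0Pl => e e0.
pose d := Num.min e (pi / 2).
have d0 : 0 < d by rewrite lt_min !divr_gt0// e0.
have dpi : d <= pi / 2 by rewrite ge_min lexx orbT.
have de : d <= e by rewrite ge_min lexx.
have dpi' : 0 < d < pi by apply/andP; split; lra.
have /andP[h _] := H0 _ dpi'.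
have : 0 <= sin d ^+ 2 / (d + 1) by rewrite divr_ge0 ?sqr_ge0//; lra.
by lra.
Qed.

Lemma cvg_atan_harmonic (d : R) : 0 < d ->
  atan (d / n.+1%:R^-1) @[n --> \oo] --> pi / 2.
Proof.
move=> d0; have cd : d / n.+1%:R^-1 @[n --> \oo] --> +oo; last first.
  exact: (cvg_comp _ _ cd (@cvgy_atan R)).
apply/cvgryPge => A; near=> n; rewrite invrK.
rewrite mulrC -ler_pdivrMr//.
have : (A / d)%R <= n%:R by near: n; exact: nbhs_infty_ger.
by move=> /le_trans; apply; rewrite ler_nat.
Unshelve. all: by end_near. Qed.

Lemma cvg_ccdf_harmonic t : 0 < t ->
  t - sin t ^+ 2 / (t + n.+1%:R^-1) @[n --> \oo] --> boundary_ccdf t.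
Proof.
move=> t0; have n0 : t + 0 != 0 by rewrite addr0 gt_eqF.
have dB := is_derive1D (is_derive1_cst t 0) (is_derive1_id (0 : R)).
have d := is_derive1B (is_derive1_cst t 0)
  (is_derive1_div (g := fun e => t + e) n0 (is_derive1_cst (sin t ^+ 2) 0) dB).
have := is_derive1_continuous d.
move=> /(cvg_comp _ _ (@cvg_harmonic R)).
by rewrite addr0.
Qed.

(** The gap between the abscissae at [t] and [t'] is [2 d]. One half absorbs the displacement of
    [boundary_curve eps t] from its limit, and the other makes the argument at [boundary_curve 0 t']
    tend to [pi]. *)
Lemma ccdf_ge t' t : 0 < t' -> t' < t -> t < pi ->
  pi * fine (mu `[boundary_curve 0 t', +oo[%classic) <= boundary_ccdf t.
Proof.
move=> t'0 t't tpi; set p := fine _.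
have p0 : 0 <= p by rewrite fine_ge0.
have t0 := lt_trans t'0 t't; have t0pi : 0 < t < pi by rewrite t0.
have w0 := boundary_curve_decr (lexx 0) t'0 t't tpi.
pose d := (boundary_curve 0 t' - boundary_curve 0 t) / 2.
have d0 : 0 < d by rewrite divr_gt0// subr_gt0.
have c1 : (pi / 2 + atan (d / n.+1%:R^-1)) * p @[n --> \oo] --> pi * p.
  have -> : pi * p = (pi / 2 + pi / 2) * p by field.
  apply: cvgM; last exact: cvg_cst.
  by apply: cvgD; [exact: cvg_cst|exact: cvg_atan_harmonic].
apply: (ler_cvg_to c1 (cvg_ccdf_harmonic t0)).
near=> n; have e0 : 0 < n.+1%:R^-1 :> R by rewrite invr_gt0.
rewrite -mean_arg_boundary//; apply: mean_arg_ge => //=.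
  by have := atan_gtNpi2 (d / n.+1%:R^-1); lra.
rewrite -lerBrDl addrAC subrr add0r -atanN le_atan// -mulNr ler_pM2r ?invr_gt0//.
have : `|boundary_curve 0 t - boundary_curve n.+1%:R^-1 t| < d.
  near: n; have /cvgrPdist_lt := boundary_curve_cvg t0pi; exact.
by rewrite ltr_norml => /andP[]; rewrite /d; lra.
Unshelve. all: by end_near. Qed.

Lemma ccdf_le t t'' : 0 < t -> t < t'' -> t'' < pi ->
  boundary_ccdf t <= pi * fine (mu `]boundary_curve 0 t'', +oo[%classic).
Proof.
move=> t0 tt'' t''pi; set p := fine _.
have p0 : 0 <= p by rewrite fine_ge0.
have t0pi : 0 < t < pi by rewrite t0 (lt_trans tt'').
have w0 := boundary_curve_decr (lexx 0) t0 tt'' t''pi.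
pose d := (boundary_curve 0 t - boundary_curve 0 t'') / 2.
have d0 : 0 < d by rewrite divr_gt0// subr_gt0.
have c1 : (pi / 2 - atan (d / n.+1%:R^-1)) + pi * p @[n --> \oo] --> pi * p.
  rewrite -[X in _ --> X]add0r -(subrr (pi / 2)).
  apply: cvgD; last exact: cvg_cst.
  by apply: cvgB; [exact: cvg_cst|exact: cvg_atan_harmonic].
apply: (ler_cvg_to (cvg_ccdf_harmonic t0) c1).
near=> n; have e0 : 0 < n.+1%:R^-1 :> R by rewrite invr_gt0.
rewrite -mean_arg_boundary//; apply: mean_arg_le => //=.
  by have := atan_ltpi2 (d / n.+1%:R^-1); lra.
rewrite lerB// le_atan// ler_pM2r ?invr_gt0//.
have : `|boundary_curve 0 t - boundary_curve n.+1%:R^-1 t| < d.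
  near: n; have /cvgrPdist_lt := boundary_curve_cvg t0pi; exact.
by rewrite ltr_norml => /andP[]; rewrite /d; lra.
Unshelve. all: by end_near. Qed.

(** Continuity of [boundary_ccdf] closes the gap between the two parameters in [ccdf_ge] and
    [ccdf_le]. *)
Lemma ccdf_boundary t : 0 < t < pi ->
  pi * fine (mu `]boundary_curve 0 t, +oo[%classic) = boundary_ccdf t.
Proof.
move=> /andP[t0 tpi].
have hc := is_derive1_continuous (is_derive_boundary_ccdf t0).
apply/eqP; rewrite eq_le; apply/andP; split; apply/ler_addgt0Pl => e e0.
  have /cvgrPdist_lt/(_ e e0) := hc.
  move=> /nbhs_ballP[r /= r0 hr].
  pose s := t + Num.min (r / 2) ((pi - t) / 2).
  have m0 : 0 < Num.min (r / 2) ((pi - t) / 2) by rewrite lt_min !divr_gt0// subr_gt0.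
  have m1 : Num.min (r / 2) ((pi - t) / 2) <= r / 2 by rewrite ge_min lexx.
  have m2 : Num.min (r / 2) ((pi - t) / 2) <= (pi - t) / 2 by rewrite ge_min lexx orbT.
  have ts : t < s by rewrite ltrDl.
  have spi : s < pi by rewrite /s; lra.
  have := hr s; rewrite /ball/= => /(_ _)/ltW.
  rewrite ler_distlC => /(_ _)/andP[]; first by rewrite ltr_distlC /s; apply/andP; split; lra.
  move=> _ hs; rewrite (le_trans _ (le_trans (ccdf_ge t0 ts spi) _))//; last by lra.
  rewrite ler_pM2l ?pi_gt0// fine_le ?fin_num_measure// le_measure ?inE//.
  by apply: subset_itvr; rewrite bnd_simp.
have /cvgrPdist_lt/(_ e e0) := hc.
move=> /nbhs_ballP[r /= r0 hr].
pose s := t - Num.min (r / 2) (t / 2).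
have m0 : 0 < Num.min (r / 2) (t / 2) by rewrite lt_min !divr_gt0.
have m1 : Num.min (r / 2) (t / 2) <= r / 2 by rewrite ge_min lexx.
have m2 : Num.min (r / 2) (t / 2) <= t / 2 by rewrite ge_min lexx orbT.
have ts : s < t by rewrite /s; lra.
have s0 : 0 < s by rewrite /s; lra.
have := hr s; rewrite /ball/= => /(_ _)/ltW.
rewrite ler_distlC => /(_ _)/andP[]; first by rewrite ltr_distlC /s; apply/andP; split; lra.
move=> hs _; have := ccdf_le s0 ts tpi; lra.
Qed.

End Distribution.

(** * A Hankel-type integral *)

Section HankelIntegral.
Context {R : realType}.
Implicit Types (s t u : R).
Local Notation leb := (@lebesgue_measure R).

Definition tcot t : R := t * cos t / sin t.

Definition dtcot t : R := cos t / sin t - t / sin t ^+ 2.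

Lemma is_derive_tcot t : 0 < t < pi -> is_derive t 1 tcot (dtcot t).
Proof.
move=> tpi; have s0 : sin t != 0 by rewrite gt_eqF// sin_gt0_pi.
apply: (is_derive_eq (is_derive1_div (f := fun t => t * cos t) s0
  (is_derive1M (is_derive1_id t) (is_derive_cos t)) (is_derive_sin t))).
rewrite /dtcot; transitivity (cos t / sin t - t * (cos t ^+ 2 + sin t ^+ 2) / sin t ^+ 2).
  by field.
by rewrite cos2Dsin2 mulr1.
Qed.

Lemma tcot_le1 t : 0 < t < pi -> tcot t <= 1.
Proof. by move=> tpi; rewrite ler_pdivrMr ?sin_gt0_pi// mul1r tcos_le_sin. Qed.

(* With [z = (t / sin t) e^(it)], so that [Im z = t] and [Re z = tcot t], these
   are [Im (e^(uz)) / u], [Im (e^(uz) z')] and [Im (e^(uz) z' / z)]. *)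
Definition hankel_prim u t : R := expR (u * tcot t) * (sin (u * t) / u).

Definition hankel_mixed u t : R :=
  expR (u * tcot t) * (dtcot t * sin (u * t) + cos (u * t)).

Definition hankel_integrand u t : R :=
  expR (u * tcot t) * ((t^-1 - cos t / sin t) * sin (u * t) + cos (u * t)).

Lemma is_derive_hankel_prim u t : u != 0 -> 0 < t < pi ->
  is_derive t 1 (hankel_prim u) (hankel_mixed u t).
Proof.
move=> u0 tpi; have s0 : sin t != 0 by rewrite gt_eqF// sin_gt0_pi.
have de := is_derive1_expf (is_derive1Z u (is_derive_tcot tpi)).
have ds := is_derive1M (is_derive1_sinf (is_derive1Z u (is_derive1_id t))) (is_derive1_cst u^-1 t).
apply: (is_derive_eq (is_derive1M de ds)).
by rewrite /hankel_mixed /=; field.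
Qed.

(** With the previous lemma, the derivative in [u] of [Im (e^(uz) z' / z)] is the derivative in [t]
    of [Im (e^(uz)) / u]. Varying [u] thus changes the integral over [t] by boundary terms only. *)
Lemma is_derive_hankel_integrand u t : 0 < t < pi ->
  is_derive u 1 (hankel_integrand^~ t) (hankel_mixed u t).
Proof.
move=> /[dup] tpi /andP[t0 _]; have s0 : sin t != 0 by rewrite gt_eqF// sin_gt0_pi.
have du c := is_derive1M (is_derive1_id u) (is_derive1_cst c u).
have de := is_derive1_expf (du (tcot t)).
have ds := is_derive1D (is_derive1Z (t^-1 - cos t / sin t) (is_derive1_sinf (du t)))
  (is_derive1_cosf (du t)).
apply: (is_derive_eq (is_derive1M de ds)) => /=.
rewrite /hankel_mixed /dtcot.
set E := expR _; set S := sin (u * t); set C := cos (u * t).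
(* The two sides agree only modulo [cos^2 + sin^2 = 1], which is inserted here so that [field] can
   conclude. *)
have -> : t / sin t ^+ 2 = t * (cos t ^+ 2 + sin t ^+ 2) / sin t ^+ 2.
  by rewrite cos2Dsin2 mulr1.
rewrite /tcot; clearbody E S C; field; rewrite s0 gt_eqF//.
Qed.

Variable n : R.
Hypothesis n_gt0 : 0 < n.

(** Zero is excluded because [hankel_prim] divides by [u]. *)
Let B : set R := `]0, n]%classic.

Let mB : measurable B. Proof. exact: measurable_itv. Qed.

Let Bfin : (leb B < +oo)%E.
Proof. by rewrite /B lebesgue_measure_itv/= lte_fin n_gt0 oppr0 adde0 ltry. Qed.

Let Bfine : fine (leb B) = n.
Proof. by rewrite /B lebesgue_measure_itv/= lte_fin n_gt0 oppr0 adde0. Qed.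

Lemma expR_tcot_le u t : 0 < t < pi -> B u -> expR (u * tcot t) <= expR n.
Proof.
move=> tpi; rewrite /B/= in_itv/= => /andP[u0 un].
by rewrite ler_expR (le_trans _ un)// ler_piMr ?tcot_le1// ltW.
Qed.

Lemma sin_div_le u t : 0 < t -> 0 < u -> `|sin (u * t) / u| <= t.
Proof.
move=> t0 u0; rewrite normrM normfV (gtr0_norm u0) ler_pdivrMr// [leRHS]mulrC.
have ut0 : 0 < u * t by rewrite mulr_gt0.
rewrite ler_norml (sin_le (ltW ut0)) andbT.
have cs : {within `[0, u * t], continuous (@sin R)}.
  by apply: continuous_subspaceT => y; exact: continuous_sin.
have [c _] := MVT ut0 (fun y _ => is_derive_sin y) cs.
rewrite sin0 !subr0 => ->; rewrite -[leLHS]mulN1r.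
by rewrite ler_wpM2r ?(ltW ut0)// cos_geN1.
Qed.

Lemma hankel_prim_le u t : 0 < t < pi -> B u ->
  `|hankel_prim u t| <= expR (u * tcot t) * t.
Proof.
move=> /andP[t0 _]; rewrite /B/= in_itv/= => /andP[u0 _].
by rewrite normrM ger0_norm ?expR_ge0// ler_wpM2l ?expR_ge0// sin_div_le.
Qed.

Lemma integrable_hankel_prim t : 0 < t < pi ->
  leb.-integrable B (EFin \o (hankel_prim^~ t)).
Proof.
move=> /[dup] tpi /andP[t0 _]; apply: measurable_bounded_integrable => //.
  apply: subspace_continuous_measurable_fun => //.
  apply: continuous_in_subspaceT => u; rewrite inE /B/= in_itv/= => /andP[u0 _].
  have du c := is_derive1M (is_derive1_id u) (is_derive1_cst c u).
  have un0 : id u != 0 by rewrite gt_eqF.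
  exact: is_derive1_continuous (is_derive1M (is_derive1_expf (du (tcot t)))
    (is_derive1_div un0 (is_derive1_sinf (du t)) (is_derive1_id u))).
exists (expR n * t); split => //= M hM u Bu.
rewrite /= (le_trans (hankel_prim_le tpi Bu))// (le_trans _ (ltW hM))//.
by rewrite ler_wpM2r ?(ltW t0)// expR_tcot_le.
Qed.

(** A primitive in [t] of [hankel_integrand n]: the term [t] is the primitive at [u = 0], where the
    integrand is 1, and the integral accumulates the change from [u = 0] to [u = n]. *)
Definition hankel_fun t : R := t + \int[leb]_(u in `]0, n]%classic) hankel_prim u t.

Lemma hankel_integrand0 t : hankel_integrand 0 t = 1.
Proof. by rewrite /hankel_integrand !mul0r expR0 sin0 cos0 mulr0 add0r mulr1. Qed.

Lemma hankel_mixed_continuous t : 0 < t < pi -> continuous (hankel_mixed^~ t).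
Proof.
move=> tpi u.
have du c := is_derive1M (is_derive1_id u) (is_derive1_cst c u).
exact: is_derive1_continuous (is_derive1M (is_derive1_expf (du (tcot t)))
  (is_derive1D (is_derive1Z (dtcot t) (is_derive1_sinf (du t))) (is_derive1_cosf (du t)))).
Qed.

Lemma Rintegral_hankel_mixed t : 0 < t < pi ->
  \int[leb]_(u in B) hankel_mixed u t = hankel_integrand n t - 1.
Proof.
move=> tpi.
have ci : {within `[0, n], continuous (hankel_mixed^~ t)}.
  by apply: continuous_subspaceT; exact: hankel_mixed_continuous.
have ii : leb.-integrable `[0, n]%classic (EFin \o (hankel_mixed^~ t)).
  by apply: continuous_compact_integrable => //; exact: segment_compact.
rewrite Rintegral_itv_obnd_cbnd; last first.
  by apply: integrableS ii => //; apply: subset_itvr; rewrite bnd_simp.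
have cI u : {for u, continuous (hankel_integrand^~ t)}.
  exact: is_derive1_continuous (is_derive_hankel_integrand u tpi).
rewrite /Rintegral (@continuous_FTC2 _ _ (hankel_integrand^~ t))//.
- by rewrite hankel_integrand0.
- split.
  + by move=> u _; have [] := is_derive_hankel_integrand u tpi.
  + exact/cvg_at_right_filter/cI.
  + exact/cvg_at_left_filter/cI.
- by move=> u _; rewrite derive1E; have [_ ->] := is_derive_hankel_integrand u tpi.
Qed.

Lemma is_derive_hankel_fun t : 0 < t < pi ->
  is_derive t 1 hankel_fun (hankel_integrand n t).
Proof.
move=> /[dup] tpi /andP[t0 tp].
have s0 : sin t != 0 by rewrite gt_eqF// sin_gt0_pi.
have cd : {for t, continuous dtcot}.
  have s20 : sin t * sin t != 0 by rewrite mulf_neq0.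
  exact: is_derive1_continuous (is_derive1B
    (is_derive1_div s0 (is_derive_cos t) (is_derive_sin t))
    (is_derive1_div (g := fun t => sin t ^+ 2) s20 (is_derive1_id t)
       (is_derive1M (is_derive_sin t) (is_derive_sin t)))).
(* Differentiation under the integral needs a bound uniform near [t]: a neighbourhood inside []0,
   pi[] on which [dtcot] is bounded. *)
have [r /= r0 hr] : exists2 r, 0 < r & forall s, `|t - s| < r ->
    (0 < s < pi) /\ `|dtcot s| <= `|dtcot t| + 1.
  have /cvgrPdist_lt/(_ 1 ltr01) /nbhs_ballP[r /= r0 hr] := cd.
  exists (Num.min r (Num.min t (pi - t))) => [|s].
    by rewrite !lt_min r0 t0 subr_gt0.
  rewrite !lt_min => /and3P[h1 h2 h3]; split.
    by move: h2 h3; rewrite !ltr_norml => /andP[_ ?] /andP[? _]; apply/andP; split; lra.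
  have := hr s h1; rewrite /= => h.
  have -> : dtcot s = dtcot t - (dtcot t - dtcot s) by ring.
  by rewrite (le_trans (ler_normB _ _))// lerD2l ltW.
have inI s : s \in `]t - r, t + r[ -> `|t - s| < r.
  by rewrite in_itv/= => /andP[s1 s2]; rewrite ltr_norml; apply/andP; split; lra.
pose f s u := hankel_prim u s.
pose C := expR n * (`|dtcot t| + 1 + 1).
have u_neq0 u : B u -> u != 0.
  by rewrite /B/= in_itv/= => /andP[u0 _]; rewrite gt_eqF.
have tI : t \in `]t - r, t + r[ by rewrite in_itv/=; apply/andP; split; lra.
have H1 s : `](t - r), (t + r)[%classic s -> leb.-integrable B (EFin \o f s).
  by move=> /= /inI/hr[spi _]; exact: integrable_hankel_prim.
have H2 s u : `](t - r), (t + r)[%classic s -> B u -> derivable (f ^~ u) s 1.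
  move=> /= /inI/hr[spi _] Bu.
  by have [] := is_derive_hankel_prim (u_neq0 u Bu) spi.
have pE s u : s \in `]t - r, t + r[ -> B u -> partial1of2 f s u = hankel_mixed u s.
  move=> /inI/hr[spi _] Bu; rewrite partial1of2E.
  by have [_ ->] := is_derive_hankel_prim (u_neq0 u Bu) spi.
have H3 (u : R) : 0 <= (cst C : R -> R) u by rewrite mulr_ge0 ?expR_ge0.
have H4 : leb.-integrable B (EFin \o (cst C : R -> R)).
  apply: measurable_bounded_integrable => //.
  exists C; split; first exact: num_real.
  by move=> M CM u _; rewrite /= ger0_norm; [exact: ltW|exact: (H3 0)].
have H5 s u : `](t - r), (t + r)[%classic s -> B u ->
    `|partial1of2 f s u| <= (cst C : R -> R) u.
  move=> /= sI Bu; have [spi ds] := hr _ (inI _ sI).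
  rewrite pE// normrM; apply: ler_pM => //.
    by rewrite ger0_norm ?expR_ge0// expR_tcot_le.
  rewrite (le_trans (ler_normD _ _))// lerD//.
    by rewrite normrM (le_trans _ ds)// ler_piMr// ler_norml sin_le1 sin_geN1.
  by rewrite ler_norml cos_le1 cos_geN1.
have H := @differentiation_under_integral R _ _ leb f B mB t _ _ tI H1 H2 _ H3 H4 H5.
have H' := @derivable_under_integral R _ _ leb f B mB t _ _ tI H1 H2 _ H3 H4 H5.
have D : is_derive t 1 (fun s => \int[leb]_(u in B) f s u) (hankel_integrand n t - 1).
  apply: DeriveDef; first exact: H'.
  rewrite -derive1E [LHS]H -Rintegral_hankel_mixed//.
  by apply: eq_Rintegral => u; rewrite inE => Bu; rewrite pE.
apply: (is_derive_eq (is_derive1D (is_derive1_id t) D)).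
by rewrite addrC subrK.
Qed.

Lemma hankel_fun_bound_left t : 0 < t < pi ->
  `|hankel_fun t - t| <= n * expR n * t.
Proof.
move=> /[dup] tpi /andP[t0 _]; rewrite /hankel_fun addrC addKr.
have ip := integrable_hankel_prim tpi.
rewrite (le_trans (le_normr_Rintegral _ ip))//.
pose C := expR n * t.
have C0 : 0 <= C by rewrite mulr_ge0 ?expR_ge0// ltW.
have ic : leb.-integrable B (EFin \o (cst C : R -> R)).
  apply: measurable_bounded_integrable => //.
  exists C; split; first exact: num_real.
  by move=> M CM u _; rewrite /= ger0_norm ?(ltW CM).
have -> : n * expR n * t = \int[leb]_(u in B) cst C u.
  by rewrite Rintegral_cst// (congr1 ( *%R C) Bfine) /C; ring.
apply: le_Rintegral => //; first exact: integrable_norm ip.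
move=> u Bu; rewrite (le_trans (hankel_prim_le tpi Bu))//.
by rewrite ler_wpM2r ?(ltW t0)// expR_tcot_le.
Qed.

(** The integral of [pi e^(u x)] over [u > 0] is [pi / (- x)], and [x = tcot t] tends to minus
    infinity at [pi]. With the bound near 0, [hankel_fun t - t] vanishes at both ends, so the total
    increment of [hankel_fun] is [pi] for every [n]. *)
Lemma hankel_fun_bound_right t : 0 < t < pi -> tcot t < 0 ->
  `|hankel_fun t - t| <= pi / (- tcot t).
Proof.
move=> /[dup] tpi /andP[t0 tp] x0; rewrite /hankel_fun addrC addKr.
have ip := integrable_hankel_prim tpi.
rewrite (le_trans (le_normr_Rintegral _ ip))//.
set x := tcot t in x0 *; have xn0 : x != 0 by rewrite lt_eqF.
pose g u := pi * expR (u * x).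
have dG u : is_derive u 1 (fun u => pi / x * expR (u * x)) (g u).
  apply: (is_derive_eq (is_derive1Z (pi / x) (is_derive1_expf
    (is_derive1M (is_derive1_id u) (is_derive1_cst x u))))).
  by rewrite /g /=; field.
have dg u : {for u, continuous g}.
  exact: is_derive1_continuous (is_derive1Z pi (is_derive1_expf
    (is_derive1M (is_derive1_id u) (is_derive1_cst x u)))).
have cg : {within `[0, n], continuous g} by exact: continuous_subspaceT.
have ig : leb.-integrable `[0, n]%classic (EFin \o g).
  by apply: continuous_compact_integrable => //; exact: segment_compact.
have igB : leb.-integrable B (EFin \o g).
  by apply: integrableS ig => //; apply: subset_itvr; rewrite bnd_simp.
have gE : \int[leb]_(u in B) g u = pi / x * expR (n * x) - pi / x.
  rewrite Rintegral_itv_obnd_cbnd// /Rintegral.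
  rewrite (@continuous_FTC2 _ _ (fun u => pi / x * expR (u * x)))//.
  - by rewrite mul0r expR0 mulr1.
  - split.
    + by move=> u _; have [] := dG u.
    + exact/cvg_at_right_filter/(is_derive1_continuous (dG 0)).
    + exact/cvg_at_left_filter/(is_derive1_continuous (dG n)).
  - by move=> u _; rewrite derive1E; have [_ ->] := dG u.
apply: (@le_trans _ _ (\int[leb]_(u in B) g u)).
  apply: le_Rintegral => //; first exact: integrable_norm ip.
  move=> u Bu; rewrite (le_trans (hankel_prim_le tpi Bu))// mulrC.
  by rewrite ler_wpM2r ?expR_ge0// ltW.
rewrite gE.
have -> : pi / - x = - (pi / x) by field.
rewrite gerDr mulr_le0_ge0 ?expR_ge0//.
by rewrite mulr_ge0_le0 ?pi_ge0// invr_le0 ltW.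
Qed.

End HankelIntegral.

(** * Lowering the power of z by integration by parts *)

Section HankelRecursion.
Context {R : realType}.
Implicit Types (s t u : R) (k m : nat).

Variable n : nat.
Hypothesis n_gt0 : (0 < n)%N.

(* With [z = (t / sin t) e^(it)], these are [Im (e^(nz) z^-k)] and
   [Im (e^(nz) z^-k z' / z)]. *)
Definition hankel_boundary k t : R := expR (n%:R * tcot t) * (sin t / t) ^+ k *
  sin ((n%:R - k%:R) * t).

Definition hankel_power k t : R := expR (n%:R * tcot t) * (sin t / t) ^+ k *
  ((t^-1 - cos t / sin t) * sin ((n%:R - k%:R) * t) + cos ((n%:R - k%:R) * t)).

Lemma hankel_power0 t : hankel_power 0 t = hankel_integrand n%:R t.
Proof. by rewrite /hankel_power expr0 mulr1 subr0. Qed.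

Lemma is_derive1X (f : R -> R) t a k : is_derive t 1 f a ->
  is_derive t 1 (fun s => f s ^+ k.+1) (k.+1%:R * f t ^+ k * a).
Proof.
move=> fa; elim: k => [|k IH]; first by rewrite expr0 !mul1r.
rewrite (_ : (fun s => _) = (fun s => f s * f s ^+ k.+1)); last first.
  by apply/funext => s; rewrite exprS.
apply: (is_derive_eq (is_derive1M fa IH)).
by rewrite -[in RHS]natr1 exprS; ring.
Qed.

(** Imaginary part of the product rule for [e^(nz) z^-(k+1)], where [e^(nz) z^-(k+1) z'] is read as
    [e^(nz) z^-k z' / z]. *)
Lemma is_derive_hankel_boundary k t : 0 < t < pi ->
  is_derive t 1 (hankel_boundary k.+1)
    (n%:R * hankel_power k t - k.+1%:R * hankel_power k.+1 t).
Proof.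
move=> /[dup] tpi /andP[t0 _].
have s0 : sin t != 0 by rewrite gt_eqF// sin_gt0_pi.
have tn0 : t != 0 by rewrite gt_eqF.
have de := is_derive1_expf (is_derive1Z n%:R (is_derive_tcot tpi)).
have dq := is_derive1X k (is_derive1_div (g := id) tn0 (is_derive_sin t) (is_derive1_id t)).
have ds := is_derive1_sinf (is_derive1Z (n%:R - k.+1%:R) (is_derive1_id t)).
apply: (is_derive_eq (is_derive1M (is_derive1M de dq) ds)) => /=.
rewrite /hankel_power /dtcot.
set phi := (n%:R - k.+1%:R) * t.
have -> : (n%:R - k%:R) * t = phi + t by rewrite /phi -natr1; ring.
rewrite sinD cosD (exprSr _ k).
have -> : t / sin t ^+ 2 = t * (cos t ^+ 2 + sin t ^+ 2) / sin t ^+ 2.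
  by rewrite cos2Dsin2 mulr1.
move: (expR _) (sin phi) (cos phi) ((sin t / t) ^+ k) => X Sp Cp Q.
by field; rewrite s0 tn0.
Qed.

(** Integrals over []0, pi[] become limits of increments between [left_seq] and [right_seq]. The
    shift by 2 keeps the distance to the end points at most 1/2, where the cosine is at least
    [cos (1/2)]. *)
Definition left_seq m : R := m.+2%:R^-1.
Definition right_seq m : R := pi - left_seq m.

Lemma left_seq_bounds m : 0 < left_seq m <= 2^-1.
Proof. by rewrite /left_seq invr_gt0 ltr0n/= lef_pV2 ?posrE ?ltr0n// ler_nat. Qed.

Lemma left_seqP m : 0 < left_seq m < pi.
Proof.
have /andP[h1 h2] := left_seq_bounds m; rewrite h1/=.
by have := @pihalf_ge1 R; lra.
Qed.

Lemma right_seqP m : 0 < right_seq m < pi.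
Proof.
have /andP[h1 h2] := left_seq_bounds m; rewrite /right_seq.
by have := @pihalf_ge1 R; move=> h; apply/andP; split; lra.
Qed.

Lemma left_seq_cvg0 : left_seq m @[m --> \oo] --> 0.
Proof.
by have := @cvg_harmonic R; rewrite -cvg_shiftS.
Qed.

Lemma eq_cvgn (f g : nat -> R) (l : R) : f =1 g ->
  f m @[m --> \oo] --> l -> g m @[m --> \oo] --> l.
Proof. by move=> /funext ->. Qed.

Lemma cvg0_le_left_seq (f : nat -> R) C : (forall m, `|f m| <= C * left_seq m) ->
  f m @[m --> \oo] --> 0.
Proof.
move=> fC; apply: norm_cvg0.
apply: (squeeze_cvgr (f := cst 0) (h := fun m => C * left_seq m)).
- by apply: nearW => m; rewrite normr_ge0 fC.
- exact: cvg_cst.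
- by rewrite -[X in _ --> X](mulr0 C); apply: cvgM; [exact: cvg_cst|exact: left_seq_cvg0].
Qed.

Let kappa : R := cos 2^-1.

Let kappa_gt0 : 0 < kappa.
Proof.
by apply: cos_gt0_pihalf; have := @pihalf_ge1 R; move=> h; apply/andP; split; lra.
Qed.

(** At [pi - d], [- tcot] equals [(pi - d) cos d / sin d], where [pi - d >= 1], [cos d >= kappa] and
    [sin d <= d]. *)
Lemma tcot_right_seq m : kappa / left_seq m <= - tcot (right_seq m).
Proof.
have /andP[d0 d1] := left_seq_bounds m; have ph := @pihalf_ge1 R.
set d := left_seq m in d0 d1 *.
have sd0 : 0 < sin d by apply: sin_gt0_pi; apply/andP; split => //; lra.
have ck : kappa <= cos d.
  rewrite /kappa; have [->//|dn] := eqVneq d 2^-1.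
  rewrite ltW// ltr_cos ?in_itv/=; last 2 first.
  - by apply/andP; split; lra.
  - by apply/andP; split; lra.
  by rewrite lt_neqAle dn.
rewrite /tcot /right_seq -/d sinB cosB sinpi cospi !mul0r sub0r addr0 !mulN1r opprK.
have -> : - ((pi - d) * - cos d / sin d) = (pi - d) * cos d / sin d by ring.
apply: ler_pM; rewrite ?invr_ge0 ?(ltW kappa_gt0) ?(ltW d0)//.
  by rewrite (le_trans ck)// ler_peMl ?(le_trans (ltW kappa_gt0) ck)//; lra.
by rewrite lef_pV2 ?posrE// sin_le// ltW.
Qed.

Lemma tcot_right_seq_lt0 m : tcot (right_seq m) < 0.
Proof.
rewrite -oppr_gt0 (lt_le_trans _ (tcot_right_seq m))// divr_gt0//.
by have /andP[] := left_seq_bounds m.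
Qed.

Lemma tcot_right_seqV m : (- tcot (right_seq m))^-1 <= kappa^-1 * left_seq m.
Proof.
have /andP[d0 _] := left_seq_bounds m.
rewrite -[left_seq m]invrK -invfM lef_pV2 ?posrE ?oppr_gt0 ?tcot_right_seq_lt0//.
  exact: tcot_right_seq.
by rewrite divr_gt0.
Qed.

(** From [e^(-y) <= 1 / y] with [y = - tcot]; a decay linear in [left_seq] is all that the limits
    require. *)
Lemma expR_tcot_right_seq m :
  expR (n%:R * tcot (right_seq m)) <= kappa^-1 * left_seq m.
Proof.
have x0 := tcot_right_seq_lt0 m.
apply: le_trans (tcot_right_seqV m).
have n1 : 1 <= n%:R :> R by rewrite ler1n.
apply: (@le_trans _ _ (expR (tcot (right_seq m)))).
  by rewrite ler_expR ler_neMl// ltW.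
rewrite -[tcot _]opprK expRN opprK lef_pV2 ?posrE ?expR_gt0 ?oppr_gt0//.
by rewrite (le_trans _ (expR_ge1Dx _))// lerDr.
Qed.

Lemma sinc_bounds t : 0 < t < pi -> 0 <= sin t / t <= 1.
Proof.
move=> /[dup] tpi /andP[t0 _].
rewrite divr_ge0 ?(ltW t0) ?(ltW (sin_gt0_pi tpi))//=.
by rewrite ler_pdivrMr// mul1r sin_le// ltW.
Qed.

Lemma norm_sin_le (x : R) : `|sin x| <= `|x|.
Proof.
wlog x0 : x / 0 <= x.
  move=> H; have [/H//|/ltW x0] := leP 0 x.
  by rewrite -[leLHS]normrN -sinN -[leRHS]normrN H// oppr_ge0.
have [->|xn0] := eqVneq x 0; first by rewrite sin0.
have xp : 0 < x by rewrite lt_neqAle eq_sym xn0.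
have := @sin_div_le R 1 x xp ltr01.
by rewrite mul1r divr1 => /le_trans; apply; rewrite ler_norm.
Qed.

Lemma hankel_boundary_left k : hankel_boundary k (left_seq m) @[m --> \oo] --> 0.
Proof.
apply: (@cvg0_le_left_seq _ (expR n%:R * `|n%:R - k%:R|)) => m.
have tpi := left_seqP m; have /andP[q0 q1] := sinc_bounds tpi.
rewrite /hankel_boundary normrM -mulrA ler_pM//.
  rewrite ger0_norm ?mulr_ge0 ?expR_ge0 ?exprn_ge0//.
  rewrite -[leRHS]mulr1 ler_pM ?expR_ge0 ?exprn_ge0 ?exprn_ile1//.
  by rewrite ler_expR ler_piMr// tcot_le1.
rewrite (le_trans (norm_sin_le _))// normrM ler_wpM2l// ger0_norm//.
by move: tpi => /andP[/ltW].
Qed.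

Lemma hankel_boundary_right k : hankel_boundary k (right_seq m) @[m --> \oo] --> 0.
Proof.
apply: (@cvg0_le_left_seq _ kappa^-1) => m.
have tpi := right_seqP m; have /andP[q0 q1] := sinc_bounds tpi.
rewrite (le_trans _ (expR_tcot_right_seq m))//.
rewrite /hankel_boundary normrM -[leRHS]mulr1 ler_pM//.
  rewrite ger0_norm ?mulr_ge0 ?expR_ge0 ?exprn_ge0//.
  by rewrite -[leRHS]mulr1 ler_pM ?expR_ge0 ?exprn_ge0 ?exprn_ile1.
by rewrite ler_norml sin_le1 sin_geN1.
Qed.

(* Integrating the derivative of [e^(nz) z^-k] gives
   [k int_k = n int_(k-1)], and [int_0 = pi]. *)
Lemma hankel_power_primitive k : exists2 F : R -> R,
  forall t, 0 < t < pi -> is_derive t 1 F (hankel_power k t) &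
  F (right_seq m) - F (left_seq m) @[m --> \oo] --> pi * (n%:R ^+ k / k`!%:R).
Proof.
have nR0 : 0 < n%:R :> R by rewrite ltr0n.
elim: k => [|k [F F' Fc]].
  exists (hankel_fun n%:R) => [t tpi|].
    by rewrite hankel_power0; exact: is_derive_hankel_fun.
  rewrite expr0 fact0 divr1 mulr1.
  pose g := hankel_fun n%:R : R -> R.
  have l0 : g (left_seq m) - left_seq m @[m --> \oo] --> 0.
    by apply: cvg0_le_left_seq => m; exact: hankel_fun_bound_left nR0 _ (left_seqP m).
  have r0 : g (right_seq m) - right_seq m @[m --> \oo] --> 0.
    apply: (@cvg0_le_left_seq _ (pi * kappa^-1)) => m.
    rewrite (le_trans (hankel_fun_bound_right nR0 (right_seqP m) (tcot_right_seq_lt0 m)))//.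
    by rewrite -mulrA ler_wpM2l ?pi_ge0// tcot_right_seqV.
  have H : g (right_seq m) - right_seq m - (g (left_seq m) - left_seq m) + pi -
      (left_seq m + left_seq m) @[m --> \oo] --> 0 - 0 + pi - (0 + 0).
    apply: cvgB; last by apply: cvgD; exact: left_seq_cvg0.
    by apply: cvgD; [exact: cvgB|exact: cvg_cst].
  rewrite !subrr add0r addr0 subr0 in H; apply: eq_cvgn H => m.
  by rewrite /right_seq /g; ring.
have k0 : k.+1%:R != 0 :> R by rewrite pnatr_eq0.
exists (fun t => (n%:R * F t - hankel_boundary k.+1 t) / k.+1%:R) => [t tpi|].
  apply: (is_derive_eq (is_derive1M (is_derive1B (is_derive1Z n%:R (F' t tpi))
    (is_derive_hankel_boundary k tpi)) (is_derive1_cst k.+1%:R^-1 t))).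
  by field.
have H : (n%:R * (F (right_seq m) - F (left_seq m)) -
    (hankel_boundary k.+1 (right_seq m) - hankel_boundary k.+1 (left_seq m))) / k.+1%:R
    @[m --> \oo] --> (n%:R * (pi * (n%:R ^+ k / k`!%:R)) - (0 - 0)) / k.+1%:R.
  apply: cvgM; last exact: cvg_cst.
  apply: cvgB; first by apply: cvgM => //; exact: cvg_cst.
  by apply: cvgB; [exact: hankel_boundary_right|exact: hankel_boundary_left].
rewrite subrr subr0 in H.
have kf : k`!%:R != 0 :> R by rewrite pnatr_eq0 -lt0n fact_gt0.
have -> : (pi : R) * (n%:R ^+ k.+1 / k.+1`!%:R) = n%:R * (pi * (n%:R ^+ k / k`!%:R)) / k.+1%:R.
  by rewrite factS natrM exprS; field; rewrite nat1r k0 kf.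
by apply: eq_cvgn H => m /=; ring.
Qed.

End HankelRecursion.

(** * Exponential moments *)

Section SqueezeDerivative.
Context {R : realType}.

(** The rule [dN = c dh] for a Stieltjes integral with monotone weight. The error [X k] lies between
    [Y k] and 0, and [Y k], a product of the increments of [c] and [h], is [o(k)]. *)
Lemma is_derive1_squeeze (N h c : R -> R) (a b t dh : R) : a < t < b ->
  (forall x y, a < x -> x < y -> y < b ->
    c y * (h y - h x) <= N y - N x <= c x * (h y - h x)) ->
  {for t, continuous c} -> is_derive t 1 h dh ->
  is_derive t 1 N (c t * dh).
Proof.
move=> /andP[at_ tb] hN cc [dh1 dh2].
pose X k := N (t + k) - N t - c t * (h (t + k) - h t).
pose Y k := (c (t + k) - c t) * (h (t + k) - h t).
have key k : k != 0 -> a < t + k < b -> `|X k| <= `|Y k|.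
  move=> k0 /andP[ak kb].
  have [XY X0] : Y k <= X k /\ X k <= 0.
    rewrite /X /Y; have [kn|kp|k0'] := ltgtP k 0; last by rewrite k0' eqxx in k0.
      have xy : t + k < t by rewrite gtrDl.
      have /andP[] := hN _ _ ak xy tb.
      move: (h (t + k)) (h t) (N (t + k)) (N t) (c (t + k)) (c t).
      by move=> h1 h0 N1 N0 c1 c0; rewrite !mulrBr !mulrBl; lra.
    have xy : t < t + k by rewrite ltrDl.
    have /andP[] := hN _ _ at_ xy kb.
    move: (h (t + k)) (h t) (N (t + k)) (N t) (c (t + k)) (c t).
    by move=> h1 h0 N1 N0 c1 c0; rewrite !mulrBr !mulrBl; lra.
  by rewrite !ler0_norm ?lerN2// (le_trans XY).
have cvh : k^-1 * (h (t + k) - h t) @[k --> 0^'] --> dh.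
  move: dh2; rewrite /derive => <-.
  have -> : (fun k => k^-1 * (h (t + k) - h t)) = (fun k => k^-1 *: (h (k *: 1 + t) - h t)).
    by apply/funext => k; rewrite /GRing.scale/= mulr1 (addrC t).
  exact: dh1.
have cvc : c (t + k) @[k --> 0^'] --> c t.
  have ct : t + k @[k --> (0 : R)^'] --> t.
    rewrite -[X in _ --> X]addr0; apply: cvgD; first exact: cvg_cst.
    exact: (@cvg_within _ (nbhs (0 : R))).
  exact: (cvg_comp _ _ ct cc).
have Z0 : `|c (t + k) - c t| * `|k^-1 * (h (t + k) - h t)| @[k --> 0^'] --> 0.
  rewrite -[X in _ --> X](mul0r `|dh|); apply: cvgM; last exact: cvg_norm.
  have : `|c (t + k) - c t| @[k --> 0^'] --> `|c t - c t|.
    by apply: cvg_norm; apply: cvgB => //; exact: cvg_cst.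
  by rewrite subrr normr0.
have X0 : k^-1 * X k @[k --> 0^'] --> 0.
  apply: norm_cvg0.
  apply: (squeeze_cvgr (f := cst 0) (h := fun k => `|c (t + k) - c t| * `|k^-1 * (h (t + k) - h t)|)) => //; last exact: cvg_cst.
  near=> k; rewrite normr_ge0/= normrM.
  have k0 : k != 0 by near: k; exact: nbhs_dnbhs_neq.
  have kb : `|k| < Num.min (t - a) (b - t).
    by near: k; apply: dnbhs0_lt; rewrite lt_min !subr_gt0 at_.
  rewrite [X in _ <= _ * X]normrM mulrCA ler_wpM2l// -normrM; apply: key => //.
  by move: kb; rewrite lt_min !ltr_norml => /andP[/andP[? _] /andP[_ ?]]; apply/andP; split; lra.
have cv : k^-1 *: (N (k *: 1 + t) - N t) @[k --> 0^'] --> c t * dh.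
  have -> : (fun k => k^-1 *: (N (k *: 1 + t) - N t)) =
      (fun k => k^-1 * X k + c t * (k^-1 * (h (t + k) - h t))).
    by apply/funext => k; rewrite /GRing.scale/= mulr1 (addrC k) /X; ring.
  rewrite -[X in _ --> X]add0r; apply: cvgD => //.
  by apply: cvgM => //; exact: cvg_cst.
by apply: DeriveDef; [apply/cvg_ex; exists (c t * dh)|apply/cvg_lim].
Unshelve. all: by end_near. Qed.

End SqueezeDerivative.

(** * Moments as limits of tail moments *)

Section ExponentialMoments.
Context {R : realType} (mu : probability R R).
Implicit Types (s t x : R).
Hypothesis ccdfE : forall t, 0 < t < pi ->
  pi * fine (mu `]boundary_curve 0 t, +oo[%classic) = boundary_ccdf t.

(** This ray lies in the tail beyond [boundary_curve 0 t] for every [t], whose mass is at most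
    [t / pi]. *)
Lemma mass_gt1 : mu `]1, +oo[%classic = 0%E.
Proof.
suff : fine (mu `]1, +oo[%classic) = 0.
  by move=> h; rewrite -[LHS]fineK ?fin_num_measure// h.
apply/eqP; rewrite eq_le fine_ge0 ?andbT//; apply/ler_addgt0Pl => e e0; rewrite addr0.
pose t := Num.min e 1; have pi2 := @pi_ge2 R.
have t0 : 0 < t by rewrite lt_min e0/=.
have t1 : t <= 1 by rewrite ge_min lexx orbT.
have te : t <= e by rewrite ge_min lexx.
have tpi : 0 < t < pi by rewrite t0/=; lra.
rewrite (le_trans _ te)//.
apply: (@le_trans _ _ (fine (mu `]boundary_curve 0 t, +oo[%classic))).
  rewrite fine_le ?fin_num_measure// le_measure ?inE//.
  by apply: subset_itvr; rewrite bnd_simp boundary_curve_le1.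
have h := boundary_ccdf_le t0; rewrite -ccdfE// in h.
by rewrite (le_trans _ h)// ler_peMl ?fine_ge0//; lra.
Qed.

Variable n : nat.
Hypothesis n_gt0 : (0 < n)%N.

(** Truncation at 1 makes the exponential bounded, hence integrable, and alters it only on the null
    set []1, +oo[]. *)
Let f x := expR (n%:R * Num.min x 1).

Let f_ge0 x : 0 <= f x. Proof. exact: expR_ge0. Qed.

Let f_le x : f x <= expR n%:R.
Proof. by rewrite ler_expR ler_piMr// ge_min lexx orbT. Qed.

Let mf : measurable_fun setT f.
Proof.
apply: measurableT_comp => //; apply: measurable_funM => //.
exact: measurable_minr.
Qed.

Let fi : mu.-integrable setT (EFin \o f).
Proof.
by apply: (@bounded_integrable _ _ _ _ _ (expR n%:R)) => // x; rewrite ger0_norm.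
Qed.

Let J t x := f x * \1_(`]boundary_curve 0 t, +oo[%classic) x.

Let J_ge0 t x : 0 <= J t x. Proof. by rewrite mulr_ge0// indicE. Qed.

Let Ji t : mu.-integrable setT (EFin \o J t).
Proof.
apply: (@bounded_integrable _ _ _ _ _ (expR n%:R)).
  by apply: measurable_funM => //; exact: measurable_indic.
move=> x; rewrite ger0_norm//.
by rewrite (le_trans _ (f_le x))// ler_piMr// indicE; case: (_ \in _).
Qed.

(** The part of the moment carried by the tail beyond [boundary_curve 0 t]; it runs from 0 to the
    full moment as [t] runs from 0 to [pi]. *)
Let N t := Rintegral mu setT (J t).

Let e t := expR (n%:R * boundary_curve 0 t).

Let T t := fine (mu `]boundary_curve 0 t, +oo[%classic).

(** Between [boundary_curve 0 t] and [boundary_curve 0 s] the function [f] lies between [e t] and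
    [e s], and [pi] times the mass of that interval is the increment of [boundary_ccdf]. *)
Let N_incr s t : 0 < s -> s < t -> t < pi ->
  e t * (boundary_ccdf t - boundary_ccdf s) <= pi * N t - pi * N s <=
  e s * (boundary_ccdf t - boundary_ccdf s).
Proof.
move=> s0 st tp.
have spi : 0 < s < pi by rewrite s0 (lt_trans st).
have tpi : 0 < t < pi by rewrite (lt_trans s0).
have wts := boundary_curve_decr (lexx 0) s0 st tp.
have ci c u : mu.-integrable setT (EFin \o (fun x => c * \1_(`]boundary_curve 0 u, +oo[%classic) x)) /\
    Rintegral mu setT (fun x => c * \1_(`]boundary_curve 0 u, +oo[%classic) x) = c * T u.
  exact: Rintegral_indicZ.
have iB (g1 g2 : R -> R) : mu.-integrable setT (EFin \o g1) -> mu.-integrable setT (EFin \o g2) ->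
    mu.-integrable setT (EFin \o (fun x => g1 x - g2 x)).
  by move=> i1 i2; exact: (integrableB measurableT i1 i2).
have cE c : c * (boundary_ccdf t - boundary_ccdf s) =
    pi * Rintegral mu setT (fun x => c * \1_(`]boundary_curve 0 t, +oo[%classic) x -
      c * \1_(`]boundary_curve 0 s, +oo[%classic) x).
  rewrite RintegralB//; [|exact: (ci c t).1|exact: (ci c s).1].
  by rewrite (ci c t).2 (ci c s).2 -!ccdfE// /T; ring.
rewrite !cE -mulrBr !ler_pM2l ?pi_gt0// -RintegralB//; [|exact: (Ji t)|exact: (Ji s)].
have [w1 w2] : boundary_curve 0 s <= 1 /\ boundary_curve 0 t <= 1.
  by split; exact: boundary_curve_le1.
apply/andP; split; apply: le_Rintegral => //.
- by apply: iB; [exact: (ci _ t).1|exact: (ci _ s).1].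
- by apply: iB; exact: Ji.
- move=> x _; rewrite /J !indicE !mem_setE !in_itv/= !andbT.
  have [xs|sx] := leP x (boundary_curve 0 s).
    have [xt|tx] := leP x (boundary_curve 0 t); first by rewrite !mulr0.
    rewrite !mulr0 !mulr1 !subr0 /e /f ler_expR ler_wpM2l//.
    by rewrite le_min w2 ltW.
  by rewrite (lt_trans wts sx) !subrr.
- by apply: iB; exact: Ji.
- by apply: iB; [exact: (ci _ t).1|exact: (ci _ s).1].
- move=> x _; rewrite /J !indicE !mem_setE !in_itv/= !andbT.
  have [xs|sx] := leP x (boundary_curve 0 s).
    have [xt|tx] := leP x (boundary_curve 0 t); first by rewrite !mulr0.
    rewrite !mulr0 !mulr1 !subr0 /e /f ler_expR ler_wpM2l//.
    by rewrite ge_min xs.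
  by rewrite (lt_trans wts sx) !subrr.
Qed.

Let eE t : 0 < t < pi -> e t = expR (n%:R * tcot t) * (sin t / t) ^+ n.
Proof.
move=> /[dup] tpi /andP[t0 _]; rewrite /e /boundary_curve addr0 mulrDr expRD.
rewrite /tcot; congr (_ * _).
by rewrite expRM_natl lnK// posrE divr_gt0// sin_gt0_pi.
Qed.

(** As [e t = e^(n tcot t) |z|^-n], only the powers [n] and [n + 1] occur: their angles are 0 and
    [- t], and the difference reproduces the derivative of [boundary_ccdf]. *)
Let N_derive t : 0 < t < pi ->
  is_derive t 1 (fun t => pi * N t) (hankel_power n n t - hankel_power n n.+1 t).
Proof.
move=> /[dup] tpi /andP[t0 _].
have ce : {for t, continuous e}.
  exact: is_derive1_continuous (is_derive1_expf (is_derive1Z n%:R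
    (is_derive_boundary_curve (lexx 0) tpi))).
have H := is_derive1_squeeze tpi N_incr ce (is_derive_boundary_ccdf t0).
apply: (is_derive_eq H); rewrite eE// /hankel_power.
have -> : (n%:R - n.+1%:R) * t = - t by rewrite -natr1; ring.
rewrite subrr mul0r sin0 cos0 mulr0 add0r mulr1 sinN cosN (exprSr _ n).
have s0 : sin t != 0 by rewrite gt_eqF// sin_gt0_pi.
move: (expR _) ((sin t / t) ^+ n) => X Q.
by field; rewrite s0 gt_eqF.
Qed.

Let N_left : N (left_seq m) @[m --> \oo] --> 0.
Proof.
apply: (@cvg0_le_left_seq _ _ (expR n%:R)) => m.
have tpi := @left_seqP R m; have /andP[t0 _] := tpi.
rewrite ger0_norm; last by apply: Rintegral_ge0 => x _; exact: J_ge0.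
have [i1 h1] := Rintegral_indicZ mu (expR n%:R)
  (measurable_itv `]boundary_curve 0 (left_seq m), +oo[).
apply: (@le_trans _ _ (expR n%:R * T (left_seq m))).
  rewrite -h1; apply: le_Rintegral => //; first exact: (Ji (left_seq m)).
  by move=> x _; rewrite ler_wpM2r// indicE.
rewrite ler_wpM2l ?expR_ge0//.
have h := boundary_ccdf_le t0; rewrite -ccdfE// in h.
rewrite (le_trans _ h)// ler_peMl ?fine_ge0//.
by have := @pi_ge2 R; lra.
Qed.

(** What is missing from the moment lies below [boundary_curve 0 t <= tcot t], where [f] is at most
    [e^(n tcot t)]; this tends to 0 as [t] tends to [pi]. *)
Let N_right : N (right_seq m) @[m --> \oo] --> Rintegral mu setT f.
Proof.
apply/subr_cvg0.
apply: (@cvg0_le_left_seq _ _ (cos 2^-1)^-1) => m.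
have tpi := @right_seqP R m.
rewrite distrC -RintegralB//; last exact: (Ji (right_seq m)).
rewrite (le_trans _ (expR_tcot_right_seq n_gt0 m))//.
apply: le_normr_Rintegral_prob.
  apply: measurable_funB => //; apply: measurable_funM => //; exact: measurable_indic.
move=> x; rewrite /J indicE mem_setE in_itv/= andbT.
have [xt|tx] := leP x (boundary_curve 0 (right_seq m)); last first.
  by rewrite mulr1 subrr normr0 expR_ge0.
rewrite mulr0 subr0 ger0_norm// /f ler_expR ler_wpM2l//.
rewrite ge_min (le_trans xt)// /boundary_curve addr0 gerDl ln_le0//.
by have /andP[] := sinc_bounds tpi.
Qed.

Lemma Rintegral_expR_min :
  Rintegral mu setT f = n%:R ^+ n / n.+1`!%:R.
Proof.
have [F1 F1' F1c] := @hankel_power_primitive R n n_gt0 n.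
have [F2 F2' F2c] := @hankel_power_primitive R n n_gt0 n.+1.
have eqN m : pi * (N (right_seq m) - N (left_seq m)) =
    (F1 (right_seq m) - F1 (left_seq m)) - (F2 (right_seq m) - F2 (left_seq m)).
  have /andP[l0 l1] := @left_seqP R m; have /andP[r0 r1] := @right_seqP R m.
  have lr : left_seq m <= right_seq m :> R.
    have /andP[_ h] := @left_seq_bounds R m; rewrite /right_seq.
    by have := @pihalf_ge1 R; lra.
  have := @derive0_segment_cst R (fun t => pi * N t - (F1 t - F2 t)) _ _ lr.
  move=> /(_ _)/eqP; rewrite -subr_eq0 => H.
  apply/eqP; rewrite -subr_eq0 -oppr_eq0; apply/eqP; rewrite -(eqP (H _)); first by ring.
  move=> t /andP[t1 t2].
  have tpi : 0 < t < pi by rewrite (lt_le_trans l0)// (le_lt_trans t2).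
  apply: (is_derive_eq (is_derive1B (N_derive tpi) (is_derive1B (F1' t tpi) (F2' t tpi)))).
  by rewrite subrr.
have c1 : pi * (N (right_seq m) - N (left_seq m)) @[m --> \oo] -->
    pi * (Rintegral mu setT f - 0).
  by apply: cvgM; [exact: cvg_cst|exact: cvgB].
have c2 : pi * (N (right_seq m) - N (left_seq m)) @[m --> \oo] -->
    pi * (n%:R ^+ n / n`!%:R) - pi * (n%:R ^+ n.+1 / n.+1`!%:R).
  by under eq_fun do rewrite eqN; exact: cvgB.
have := cvg_unique (@Rhausdorff R) c1 c2.
rewrite subr0 -mulrBr => h; rewrite (mulfI (lt0r_neq0 (pi_gt0 R)) (h _)).
have kf : n`!%:R != 0 :> R by rewrite pnatr_eq0 -lt0n fact_gt0.
have k0 : n.+1%:R != 0 :> R by rewrite pnatr_eq0.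
(* [n^n / n! - n^(n+1) / (n+1)! = n^n ((n + 1) - n) / (n+1)!]. *)
rewrite factS natrM exprS -natr1; field; rewrite kf /=.
by rewrite natr1.
Qed.

Lemma integral_expR_pow :
  (\int[mu]_x (expR x ^+ n)%:E = (n%:R ^+ n / n.+1`!%:R)%:E)%E.
Proof.
rewrite -Rintegral_expR_min /Rintegral fineK; last exact: integrable_fin_num.
apply: ae_eq_integral => //.
- apply/measurable_EFinP; apply: measurable_funX; exact: measurable_expR.
- by apply/measurable_EFinP.
exists `]1, +oo[%classic; split => //; first exact: mass_gt1.
move=> x /= hx; rewrite in_itv/= andbT ltNge; apply/negP => x1.
by apply: hx => _; rewrite /f min_l// expRM_natl.
Qed.

End ExponentialMoments.

(** * Determinacy of moments *)

Section MomentDeterminacy.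
Context {R : realType}.
Implicit Types (x y s t u : R) (m : probability R R).

Lemma onem_pow_ge (y : R) (N : nat) : 0 <= y <= 1 -> 1 - N%:R * y <= (1 - y) ^+ N.
Proof.
move=> /andP[y0 y1]; elim: N => [|N IH]; first by rewrite mul0r subr0 expr0.
have y1' : 0 <= 1 - y by rewrite subr_ge0.
rewrite exprS (le_trans _ (ler_wpM2l y1' IH))//.
have : 0 <= N%:R * (y * y) by rewrite !mulr_ge0.
by rewrite -natr1; lra.
Qed.

(** Bernoulli's inequality for [1 + y], together with [(1 - y) (1 + y) <= 1]. It makes [(1 - y)^N]
    small where [N y] is large. *)
Lemma onem_pow_le (y : R) (N : nat) : 0 <= y <= 1 -> (1 - y) ^+ N * (1 + N%:R * y) <= 1.
Proof.
move=> /andP[y0 y1]; have y1' : 0 <= 1 - y by rewrite subr_ge0.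
have bern : 1 + N%:R * y <= (1 + y) ^+ N.
  elim: N => [|N IH]; first by rewrite mul0r addr0 expr0.
  have y2 : 0 <= 1 + y by rewrite addr_ge0.
  rewrite exprS (le_trans _ (ler_wpM2l y2 IH))//.
  have : 0 <= N%:R * (y * y) by rewrite !mulr_ge0.
  by rewrite -natr1; lra.
rewrite (le_trans (ler_wpM2l (exprn_ge0 N y1') bern))// -exprMn.
have -> : (1 - y) * (1 + y) = 1 - y ^+ 2 by ring.
by rewrite exprn_ile1 ?subr_ge0 ?exprn_ile1// lerBlDr lerDl sqr_ge0.
Qed.

Variable c : R.
Hypothesis c_gt0 : 0 < c.

(** Polynomials in [clamp x] are bounded on the whole line, while [clamp] is the identity on the
    support. *)
Definition clamp x : R := Num.max 0 (Num.min x c).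

Lemma clamp_bounds x : 0 <= clamp x <= c.
Proof. by rewrite /clamp le_max lexx/= ge_max ge_min lexx orbT (ltW c_gt0). Qed.

Lemma clamp_id x : 0 <= x <= c -> clamp x = x.
Proof. by move=> /andP[x0 xc]; rewrite /clamp min_l// max_r. Qed.

Lemma clamp_div_bounds x : 0 <= clamp x / c <= 1.
Proof.
have /andP[h0 h1] := clamp_bounds x.
by rewrite divr_ge0 ?(ltW c_gt0)//= ler_pdivrMr// mul1r.
Qed.

Lemma measurable_clamp : measurable_fun setT clamp.
Proof. by apply: measurable_maxr => //; exact: measurable_minr. Qed.

Lemma ler_clamp x y : x <= y -> clamp x <= clamp y.
Proof. by move=> xy; rewrite /clamp le_max2 ?le_min2. Qed.

Let poly_eq m1 m2 (g : R -> R) : Prop :=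
  [/\ m1.-integrable setT (EFin \o g), m2.-integrable setT (EFin \o g)
    & Rintegral m1 setT g = Rintegral m2 setT g].

Section two_measures.
Variables m1 m2 : probability R R.
Hypothesis m1_supp : m1 (~` `[0, c]%classic) = 0%E.
Hypothesis m2_supp : m2 (~` `[0, c]%classic) = 0%E.
Hypothesis mom : forall n : nat, (\int[m1]_x (x ^+ n)%:E = \int[m2]_x (x ^+ n)%:E)%E.

Let measurable_clampX n : measurable_fun setT (fun x => clamp x ^+ n).
Proof. by apply: measurable_funX; exact: measurable_clamp. Qed.

Let clampX_bounded n x : `|clamp x ^+ n| <= c ^+ n.
Proof.
have /andP[h0 h1] := clamp_bounds x.
by rewrite ger0_norm ?exprn_ge0// lerXn2r ?nnegrE ?(ltW c_gt0).
Qed.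

Let clamp_mom m n : m (~` `[0, c]%classic) = 0%E ->
  (\int[m]_x (clamp x ^+ n)%:E = \int[m]_x (x ^+ n)%:E)%E.
Proof.
move=> m0; apply: ae_eq_integral => //.
- by apply/measurable_EFinP; exact: measurable_clampX.
- by apply/measurable_EFinP; exact: measurable_funX.
exists (~` `[0, c]%classic); split => //; first exact: measurableC.
move=> x /= hx; rewrite in_itv/= => xc; apply: hx => _.
by rewrite clamp_id.
Qed.

Let poly_eqX n : poly_eq m1 m2 (fun x => clamp x ^+ n).
Proof.
split.
- exact: (bounded_integrable m1 (measurable_clampX n) (clampX_bounded n)).
- exact: (bounded_integrable m2 (measurable_clampX n) (clampX_bounded n)).
- by rewrite /Rintegral !clamp_mom// mom.
Qed.

Let poly_eqD g1 g2 : poly_eq m1 m2 g1 -> poly_eq m1 m2 g2 ->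
  poly_eq m1 m2 (fun x => g1 x + g2 x).
Proof.
move=> [i1 j1 e1] [i2 j2 e2]; split.
- exact: (integrableD measurableT i1 i2).
- exact: (integrableD measurableT j1 j2).
- by rewrite !RintegralD// e1 e2.
Qed.

Let poly_eqZ (a : R) g : poly_eq m1 m2 g -> poly_eq m1 m2 (fun x => a * g x).
Proof.
move=> [i1 j1 e1]; split; [exact: integrableMl_cst|exact: integrableMl_cst|].
by rewrite !RintegralZl// e1.
Qed.

Let poly_eq_horner (p : {poly R}) : poly_eq m1 m2 (fun x => p.[clamp x]).
Proof.
rewrite (_ : (fun x => _) = (fun x => \sum_(i < size p) p`_i * clamp x ^+ i)); last first.
  by apply/funext => x; rewrite horner_coef.
elim: (size p) => [|k IH].
  rewrite (_ : (fun x => _) = (fun x => 0 * clamp x ^+ 0)); last first.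
    by apply/funext => x; rewrite big_ord0 mul0r.
  exact/poly_eqZ/poly_eqX.
rewrite (_ : (fun x => _) = (fun x => \sum_(i < k) p`_i * clamp x ^+ i + p`_k * clamp x ^+ k)); last first.
  by apply/funext => x; rewrite big_ord_recr.
by apply: poly_eqD => //; exact/poly_eqZ/poly_eqX.
Qed.

Let poly_eq_onem (k N : nat) :
  poly_eq m1 m2 (fun x => (1 - (clamp x / c) ^+ k) ^+ N).
Proof.
rewrite (_ : (fun x => _) = (fun x => ((1 - (c^-1 *: 'X) ^+ k) ^+ N).[clamp x])).
  exact: poly_eq_horner.
by apply/funext => x; rewrite !hornerE mulrC.
Qed.

(* With [N] close to [(c / t)^k], [(1 - (x / c)^k)^N] tends to 1 for [x < t] and
   to 0 for [t < x] as [k] tends to infinity. *)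
Let ray_le s t u (k : nat) : 0 < s -> s < t -> t < u -> u <= c ->
  (1 - 2 * (s / t) ^+ k) * fine (m1 `]-oo, s]%classic) <=
  fine (m2 `]-oo, u[%classic) + (t / u) ^+ k.
Proof.
move=> s0 st tu uc.
have t0 := lt_trans s0 st; have u0 := lt_trans t0 tu.
have tc := lt_le_trans tu uc.
have rho1 : 1 <= c / t by rewrite ler_pdivlMr// mul1r ltW.
have rk1 : 1 <= (c / t) ^+ k by exact: exprn_ege1.
(* The power is at least 1, so rounding it up at most doubles it; hence the factor 2 in the
   statement. *)
pose N := (Num.truncn ((c / t) ^+ k)).+1.
have /andP[N1 N2] : (c / t) ^+ k <= N%:R <= 2 * (c / t) ^+ k.
  have := @truncn_itv R ((c / t) ^+ k) (le_trans ler01 rk1) => /andP[h1 h2].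
  by rewrite /N (ltW h2)/= -natr1; lra.
have [i1 i2 e12] := poly_eq_onem k N.
have kc x : 0 <= (clamp x / c) ^+ k <= 1.
  have /andP[h0 h1] := clamp_div_bounds x.
  by rewrite exprn_ge0// exprn_ile1.
have ge0 x : 0 <= (1 - (clamp x / c) ^+ k) ^+ N.
  by rewrite exprn_ge0// subr_ge0; have /andP[] := kc x.
have le1 x : (1 - (clamp x / c) ^+ k) ^+ N <= 1.
  have /andP[h0 h1] := kc x.
  by rewrite exprn_ile1 ?subr_ge0// gerBl.
have [j1 f1] := Rintegral_indicZ m1 (1 - 2 * (s / t) ^+ k) (measurable_itv `]-oo, s]).
have [j2 f2] := Rintegral_indicZ m2 1 (measurable_itv `]-oo, u[).
have j3 : m2.-integrable setT (EFin \o cst ((t / u) ^+ k)).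
  exact: finite_measure_integrable_cst.
have f3 : Rintegral m2 setT (cst ((t / u) ^+ k)) = (t / u) ^+ k.
  by rewrite Rintegral_cst// (congr1 (fun e => _ * fine e) (probability_setT m2)) mulr1.
have -> : fine (m2 `]-oo, u[%classic) + (t / u) ^+ k =
    Rintegral m2 setT (fun x => 1 * \1_(`]-oo, u[%classic) x + cst ((t / u) ^+ k) x).
  by rewrite RintegralD// f2 f3 mul1r.
rewrite -f1.
apply: (@le_trans _ _ (Rintegral m1 setT (fun x => (1 - (clamp x / c) ^+ k) ^+ N))).
  apply: le_Rintegral => // x _; rewrite indicE mem_setE in_itv/=.
  have [xs|sx] := leP x s; last by rewrite mulr0.
  rewrite mulr1 (le_trans _ (onem_pow_ge N (kc x)))// lerB//.
  have cs : (clamp x / c) ^+ k <= (s / c) ^+ k.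
    have /andP[h0 h1] := clamp_div_bounds x.
    rewrite lerXn2r ?nnegrE ?divr_ge0 ?(ltW s0) ?(ltW c_gt0)//.
      by have /andP[] := clamp_bounds x.
    rewrite ler_pM2r ?invr_gt0// (le_trans (ler_clamp xs))// clamp_id//.
    by rewrite (ltW s0) ltW// (lt_trans st).
  have -> : 2 * (s / t) ^+ k = 2 * (c / t) ^+ k * (s / c) ^+ k.
    by rewrite -mulrA -exprMn; congr (_ * _ ^+ _); field; rewrite !gt_eqF.
  by rewrite ler_pM//; have /andP[] := kc x.
rewrite e12; apply: le_Rintegral => //; first exact: (integrableD measurableT j2 j3).
move=> x _; rewrite indicE mem_setE in_itv/= mul1r.
have [xu|ux] := ltP x u.
  by rewrite (le_trans (le1 x))// lerDl exprn_ge0// divr_ge0 ?(ltW t0) ?(ltW u0).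
rewrite add0r.
have cu : (u / c) ^+ k <= (clamp x / c) ^+ k.
  have /andP[h0 h1] := clamp_div_bounds x.
  rewrite lerXn2r ?nnegrE ?divr_ge0 ?(ltW u0) ?(ltW c_gt0)//.
    by have /andP[] := clamp_bounds x.
  rewrite ler_pM2r ?invr_gt0// -[leLHS]clamp_id ?(ltW u0)//.
  exact: ler_clamp.
have Nk : (u / t) ^+ k <= N%:R * (clamp x / c) ^+ k.
  have -> : (u / t) ^+ k = (c / t) ^+ k * (u / c) ^+ k.
    by rewrite -exprMn; congr (_ ^+ _); field; rewrite !gt_eqF.
  by rewrite ler_pM// exprn_ge0// divr_ge0 ?(ltW u0) ?(ltW t0) ?(ltW c_gt0).
have ut0 : 0 < (u / t) ^+ k by rewrite exprn_gt0// divr_gt0.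
have -> : (t / u) ^+ k = ((u / t) ^+ k)^-1 by rewrite -exprVn invf_div.
rewrite -[leRHS]mul1r ler_pdivlMr//.
rewrite (le_trans _ (onem_pow_le N (kc x)))// ler_wpM2l//.
by rewrite (le_trans Nk)// lerDr.
Qed.

Lemma moment_ray_le s u : s < u ->
  fine (m1 `]-oo, s]%classic) <= fine (m2 `]-oo, u[%classic).
Proof.
move=> su.
have [s0|s0] := ltP s 0.
  rewrite (@le_trans _ _ 0) ?fine_ge0//.
  rewrite -[leRHS](congr1 fine m1_supp) fine_le ?fin_num_measure//.
    exact: measurableC.
  rewrite le_measure ?inE//; first exact: measurableC.
  move=> x /=; rewrite !in_itv/= => xs; apply/negP.
  by rewrite negb_and -ltNge (le_lt_trans xs s0).
have [uc|cu] := leP u c; last first.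
  have -> : fine (m2 `]-oo, u[%classic) = 1.
    have h : (1 <= m2 `]-oo, u[%classic)%E.
      have <- : m2 `[0, c]%classic = 1%E.
        have := probability_setC m2 (measurable_itv `[0, c]).
        rewrite m2_supp -[in RHS](fineK (fin_num_measure m2 _ (measurable_itv `[0, c]))).
        rewrite -EFinB => -[h]; rewrite -[LHS]fineK ?fin_num_measure//.
        by congr EFin; apply/eqP; rewrite eq_sym -subr_eq0 -h.
      rewrite le_measure ?inE// => x /=; rewrite !in_itv/= => /andP[_ xc].
      exact: le_lt_trans xc cu.
    have := probability_le1 m2 (measurable_itv `]-oo, u[).
    by move=> h'; apply/eqP; rewrite -eqe fineK ?fin_num_measure// eq_le h' h.
  have := probability_le1 m1 (measurable_itv `]-oo, s]).
  by rewrite -[X in (X <= _)%E]fineK ?fin_num_measure// lee_fin.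
(* [s] may be 0, whereas [ray_le] requires a positive left point. *)
pose s' := (s + u) / 2; pose t := (s' + u) / 2.
have s'0 : 0 < s' by rewrite /s'; lra.
have s't : s' < t by rewrite /t /s'; lra.
have tu : t < u by rewrite /t /s'; lra.
have t0 : 0 < t by rewrite (lt_trans s'0).
have u0 : 0 < u by rewrite (lt_trans t0).
apply: (@le_trans _ _ (fine (m1 `]-oo, s']%classic))).
  rewrite fine_le ?fin_num_measure// le_measure ?inE//.
  by apply: subset_itvl; rewrite bnd_simp /s'; lra.
have c1 : (1 - 2 * (s' / t) ^+ k) * fine (m1 `]-oo, s']%classic) @[k --> \oo] -->
    (1 - 2 * 0) * fine (m1 `]-oo, s']%classic).
  apply: cvgM; last exact: cvg_cst.
  apply: cvgB; first exact: cvg_cst.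
  apply: cvgM; first exact: cvg_cst.
  apply: cvg_expr; rewrite (ger0_norm (divr_ge0 (ltW s'0) (ltW t0))).
  by rewrite ltr_pdivrMr// mul1r.
have c2 : fine (m2 `]-oo, u[%classic) + (t / u) ^+ k @[k --> \oo] -->
    fine (m2 `]-oo, u[%classic) + 0.
  apply: cvgD; first exact: cvg_cst.
  apply: cvg_expr; rewrite (ger0_norm (divr_ge0 (ltW t0) (ltW u0))).
  by rewrite ltr_pdivrMr// mul1r.
have := ler_cvg_to c1 c2; rewrite mulr0 subr0 mul1r addr0; apply.
by apply: nearW => k; exact: ray_le.
Qed.

(** An open ray is an increasing union of closed rays, which removes the gap between [s] and [u].
    Exchanging the measures gives the opposite inequality. *)
Lemma moment_ray_lt u : (m1 `]-oo, u[%classic <= m2 `]-oo, u[%classic)%E.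
Proof.
have uE : `]-oo, u[%classic = \bigcup_n `]-oo, u - n.+1%:R^-1]%classic.
  apply/seteqP; split => x; last first.
    move=> [n _]; rewrite /= !in_itv/= => /le_lt_trans; apply.
    by rewrite ltrBlDr ltrDl invr_gt0.
  rewrite /= in_itv/= => xu.
  have [n hn] : exists n : nat, (u - x)^-1 < n.+1%:R.
    exists (Num.truncn (u - x)^-1); exact: truncnS_gt.
  exists n => //=; rewrite in_itv/= lerBrDr -lerBrDl.
  by rewrite -[leRHS]invrK lef_pV2 ?posrE ?invr_gt0 ?subr_gt0// ltW.
have := @nondecreasing_cvg_mu _ _ _ m1 (fun n => `]-oo, u - n.+1%:R^-1]%classic).
rewrite -uE => /(_ _ _ _) H.
apply: (cvge_le _ (H _ _ _)); last 3 first.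
- by move=> i; exact: measurable_itv.
- exact: measurable_itv.
- move=> i j ij; apply/subsetPset; apply: subset_itvl; rewrite bnd_simp lerB//.
  by rewrite lef_pV2 ?posrE// ler_nat.
apply: nearW => n /=.
rewrite -[leLHS]fineK ?fin_num_measure// -[leRHS]fineK ?fin_num_measure// lee_fin.
by apply: moment_ray_le; rewrite ltrBlDr ltrDl invr_gt0.
Qed.

End two_measures.

Theorem moment_determinacy m1 m2 :
  m1 (~` `[0, c]%classic) = 0%E -> m2 (~` `[0, c]%classic) = 0%E ->
  (forall n : nat, (\int[m1]_x (x ^+ n)%:E = \int[m2]_x (x ^+ n)%:E)%E) ->
  forall A : set R, measurable A -> m1 A = m2 A.
Proof.
move=> s1 s2 mom A mA.
apply: (measure_unique (@RGenInftyO.G R) (fun n => `]-oo, n%:R[%classic)) mA.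
- exact: RGenInftyO.measurableE.
- move=> _ _ [x ->] [y ->]; exists (Num.min x y).
  by apply/seteqP; split => z /=; rewrite !in_itv/= lt_min => /andP.
- by move=> n; exists n%:R.
- apply/seteqP; split => // x _; exists (Num.truncn x).+1 => //=.
  by rewrite in_itv/= truncnS_gt.
- by move=> _ [u ->]; apply/eqP; rewrite eq_le !moment_ray_lt.
- by move=> n; rewrite (le_lt_trans (probability_le1 _ (measurable_itv _))) ?ltry.
Qed.

End MomentDeterminacy.

(** * The Dykema-Haagerup distribution *)

Section DykemaHaagerup.
Context {R : realType}.

(** By induction from [(1 + 1/n)^n <= e]; it shows that the [n]-th moment is at most [e^n]. *)
Lemma natr_pow_le_fact (n : nat) : n%:R ^+ n <= expR 1 ^+ n * n`!%:R :> R.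
Proof.
elim: n => [|n IH]; first by rewrite !expr0 mul1r fact0.
have e1 : 0 <= expR 1 :> R by exact: expR_ge0.
rewrite factS natrM exprS [expR 1 ^+ _]exprS.
rewrite (_ : expR 1 * expR 1 ^+ n * (n.+1%:R * n`!%:R) =
  n.+1%:R * (expR 1 * (expR 1 ^+ n * n`!%:R))); last by ring.
rewrite ler_wpM2l//; have [->|n0] := posnP n.
  by rewrite !expr0 fact0 !mulr1 (le_trans _ (expR_ge1Dx _))// lerDl.
apply: le_trans (ler_wpM2l e1 IH).
have nR : 0 < n%:R :> R by rewrite ltr0n.
have -> : n.+1%:R ^+ n = (1 + n%:R^-1) ^+ n * n%:R ^+ n :> R.
  by rewrite -exprMn mulrDl mul1r mulVf ?gt_eqF// natr1.
rewrite ler_wpM2r ?exprn_ge0//.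
have -> : expR 1 = expR n%:R^-1 ^+ n :> R.
  by rewrite -expRM_natl divff// gt_eqF.
by rewrite lerXn2r ?nnegrE ?expR_ge0 ?addr_ge0 ?invr_ge0 ?expR_ge1Dx.
Qed.

(** Markov's inequality: the mass beyond [2 e] is at most [e^n / (2 e)^n = 2^-n]. Doubling [e] is
    what makes the bound tend to 0. *)
Lemma dykema_haagerup_support (m : probability R R) : is_dykema_haagerup1 m ->
  m (~` `[0, 2 * expR 1]%classic) = 0%E.
Proof.
move=> [m0 mom]; set c := 2 * expR 1; have e0 := @expR_gt0 R 1.
have c0 : 0 < c by rewrite mulr_gt0.
have mc : m `]c, +oo[%classic = 0%E.
  suff : fine (m `]c, +oo[%classic) = 0.
    by move=> h; rewrite -[LHS]fineK ?fin_num_measure// h.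
  apply/eqP; rewrite eq_le fine_ge0 ?andbT//; apply/ler_addgt0Pl => e ep; rewrite addr0.
  (* The exponent is even, [n = 2 k], so that [x^n] is nonnegative on the whole line; the bound
     [2^-n] is then [4^-k]. *)
  have half : 0 <= (4^-1 : R) < 1 by apply/andP; split; lra.
  have [k hk] := geometric_lt_ex 1 half ep; rewrite mul1r in hk.
  pose n := k.*2.
  have qk : 2^-1 ^+ n = 4^-1 ^+ k :> R.
    by rewrite /n -mul2n exprM exprVn -natrX.
  rewrite (le_trans _ (ltW hk))// -qk.
  have xn0 (x : R) : 0 <= x ^+ n by rewrite exprn_even_ge0// odd_double.
  have [_ iE] := Rintegral_indicZ m (c ^+ n) (measurable_itv `]c, +oo[).
  have h1 : (\int[m]_x (c ^+ n * \1_(`]c, +oo[%classic) x)%:E <= \int[m]_x (x ^+ n)%:E)%E.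
    apply: ge0_le_integral => //.
    - by move=> x _; rewrite lee_fin mulr_ge0 ?exprn_ge0 ?(ltW c0)// indicE.
    - by apply/measurable_EFinP; apply: measurable_funM => //; exact: measurable_indic.
    - by apply/measurable_EFinP; exact: measurable_funX.
    - move=> x _; rewrite lee_fin indicE mem_setE in_itv/= andbT.
      have [cx|_] := ltP c x; last by rewrite mulr0.
      by rewrite mulr1 lerXn2r ?nnegrE ?(ltW c0)// ?(ltW cx)// (le_trans (ltW c0))// ltW.
  have h2 : c ^+ n * fine (m `]c, +oo[%classic) <= n%:R ^+ n / n.+1`!%:R.
    have [ii _] := Rintegral_indicZ m (c ^+ n) (measurable_itv `]c, +oo[).
    rewrite -lee_fin -mom -iE /Rintegral fineK//; exact: integrable_fin_num.
  have h3 : n%:R ^+ n / n.+1`!%:R <= expR 1 ^+ n :> R.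
    rewrite ler_pdivrMr ?ltr0n ?fact_gt0// (le_trans (natr_pow_le_fact n))//.
    rewrite ler_wpM2l ?exprn_ge0 ?(ltW e0)// ler_nat factS leq_pmull//.
  have := le_trans h2 h3; rewrite /c exprMn mulrAC -ler_pdivlMr ?exprn_gt0//.
  rewrite divff ?expf_neq0 ?gt_eqF// => h4.
  by rewrite exprVn -[leRHS]mul1r ler_pdivlMr ?exprn_gt0// mulrC.
have mn : m `]-oo, 0[%classic = 0%E.
  have -> : `]-oo, 0[%classic = ~` [set x : R | 0 <= x].
    apply/seteqP; split => x /=; rewrite in_itv/= ltNge; first by move/negP.
    by move=> /negP.
  have m0' : measurable [set x : R | 0 <= x].
    have -> : [set x : R | 0 <= x] = `[0, +oo[%classic.
      by apply/seteqP; split => x /=; rewrite in_itv/= andbT.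
    exact: measurable_itv.
  by rewrite probability_setC// m0 subee.
apply/eqP; rewrite -measure_le0.
rewrite (@le_trans _ _ (m (`]-oo, 0[%classic `|` `]c, +oo[%classic)))//.
  rewrite le_measure ?inE//; first exact: measurableC.
    exact: measurableU.
  move=> x /=; rewrite !in_itv/= andbT => /negP.
  by rewrite negb_and -!ltNge => /orP.
apply: (@le_trans _ _ (m `]-oo, 0%R[%classic + m `]c, +oo[%classic)%E).
  exact: measureU2.
by rewrite mn mc adde0.
Qed.

(** The point [i y] has real part 0, so it lies in the truncated cone of any aperture once [y > b];
    there [g (i y) = i y - Log (i y)] and [F (g (i y)) = i y]. *)
Lemma free_stable1_curve (mu : probability R R) : is_free_stable1 mu ->
  exists2 b, 2 <= b &
    forall y, b < y -> cauchy_transform mu (log_curve y) = (0 +i* y)^-1.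
Proof.
move=> [a [b [a0 b0 [a' [b' [g [_ _ _ gF gphi]]]]]]].
(* Since [pi / 2 < 2], the maximum keeps [log_curve y] in the upper half-plane. *)
exists (Num.max b 2); first by rewrite le_max lexx orbT.
move=> y; rewrite gt_max => /andP[yb y2].
have y0 : 0 < y by rewrite (lt_trans b0).
have zy : modulus (0 +i* y) = y.
  by rewrite /modulus/= expr0n/= add0r sqrtr_sqr gtr0_norm.
have zD : (0 +i* y) \in truncated_cone a b.
  by rewrite inE; split; [exact: y0|rewrite /= normr0 mulr_gt0|rewrite zy].
have [_ Fz] := gF _ zD; have := gphi _ zD.
have LogE : Log (0 +i* y) = ln y +i* (pi / 2).
  by rewrite /Log zy /Arg /= (ltW y0) mul0r acos0.
rewrite LogE => gE.
have {}gE : g (0 +i* y) = log_curve y.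
  rewrite -[LHS](subrK (0 +i* y)) -gE; apply/eqP; rewrite eq_complex/=.
  by apply/andP; split; apply/eqP; rewrite ?addr0// addrC.
by rewrite -Fz gE /reciprocal_cauchy_transform invrK.
Qed.

End DykemaHaagerup.

Local Close Scope complex_scope.

Theorem proposition4p4 (R : realType) (d : measure_display)
    (T : measurableType d) (P : probability T R) (F1 : {RV P >-> R})
    (DH1 : probability R R)
    (hF1 : is_free_stable1 (distribution P F1))
    (hDH1 : is_dykema_haagerup1 DH1) :
  forall A : set R, measurable A ->
    DH1 A = distribution P (expR \o F1 : {RV P >-> R}) A.
Proof.
pose mu : probability R R := distribution P F1.
pose c : R := 2 * expR 1; have e0 := @expR_gt0 R 1.
have c0 : 0 < c by rewrite mulr_gt0.
have [b b2 GE] := free_stable1_curve hF1.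
have ccdfE := ccdf_boundary (mu := mu) b2 GE.
have mom n : (\int[mu]_x (expR x ^+ n)%:E = (n%:R ^+ n / n.+1`!%:R)%:E)%E.
  (* The contour argument assumes [n > 0]; the moment of order 0 is the total mass. *)
  have [->|n0] := posnP n; last exact: integral_expR_pow.
  rewrite expr0 divr1; under eq_integral do rewrite expr0.
  by rewrite integral_cst// mul1e; exact: (probability_setT mu).
have mexp n : measurable_fun setT (fun x : R => (expR x ^+ n)%:E).
  by apply/measurable_EFinP; apply: measurable_funX; exact: measurable_expR.
have momP n : (\int[P]_w (expR (F1 w) ^+ n)%:E = (n%:R ^+ n / n.+1`!%:R)%:E)%E.
  by rewrite -mom (ge0_integral_distribution F1 (mexp n))//.
apply: (moment_determinacy c0).
- exact: dykema_haagerup_support.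
(* [expR x > 2 e] forces [x > 1], a null event. *)
- apply/eqP; rewrite -measure_le0 -(mass_gt1 ccdfE).
  change (mu (expR @^-1` (~` `[0%R, c]%classic)) <= mu `]1%R, +oo[%classic)%E.
  rewrite le_measure ?inE//.
    rewrite -[X in measurable X]setTI; apply: measurable_expR => //.
    exact: measurableC.
  move=> x /=; rewrite !in_itv/= andbT expR_ge0/= => /negP; rewrite -ltNge => cx.
  by rewrite -ltr_expR (le_lt_trans _ cx)// /c; lra.
move=> n; rewrite hDH1.2 -momP.
rewrite (integral_distribution (X := expR \o F1 : {RV P >-> R}))//.
- by apply/measurable_EFinP; exact: measurable_funX.
- apply/integrableP; split.
    apply: (measurableT_comp (mexp n)); exact: measurable_funPT.
  rewrite (_ : (\int[P]_x _ = \int[P]_w (expR (F1 w) ^+ n)%:E)%E).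
    by rewrite momP ltry.
  apply: eq_integral => w _ /=; rewrite ger0_norm// exprn_ge0// expR_ge0.
Qed.
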